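(* Let $(e_i)$ be a right dominant normalized basic sequence which dominates all of its normalized block bases, and let $J(e_i)$ be as in the context. Then the following are equivalent: (a) for every closed subspace $E$ of $J(e_i)$, every bounded linear operator from $E$ into $J(e_i)'$ is compact; (b) the sequence $(e_i)$ does not dominate $(e_i')$, where $(e_i')$ is the sequence of biorthogonal functionals of $(e_i)$ in $[e_i]'$.
   Context: A basic sequence $(x_i)$ is right dominant if it is unconditional and there is a constant $D$ such that whenever $1\le m(1)\le n(1)<m(2)\le n(2)<\dots$ and $(a_{n(i)})$ is finitely nonzero, $\|\sum a_{n(i)}x_{m(i)}\|\le D\|\sum a_{n(i)}x_{n(i)}\|$. A sequence $(x_i)$ dominates $(y_i)$ if there is $C$ with $\|\sum a_iy_i\|\le C\|\sum a_ix_i\|$ for all finitely nonzero real $(a_i)$. $[e_i]$ is the closed linear span of $(e_i)$. For finitely nonzero real $(a_i)$ define \[\Big\|\sum a_iu_i\Big\|=\sup\Big\{\Big\|\sum_{i=1}^k\Big(\sum_{j=p(i)}^{p(i+1)-1}a_j\Big)e_{p(i)}\Big\| : k\in\mathbb N,\ 1=p(1)<p(2)<\dots<p(k+1)\Big\},\] and let $J(e_i)$ be the completion of the span of the formal vectors $(u_i)$ under this norm. *)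

(* Defs.v *)
From HB Require Import structures.
From mathcomp Require Import all_boot all_order all_algebra.
From mathcomp Require Import all_classical all_reals all_analysis.
Set Implicit Arguments. Unset Strict Implicit. Unset Printing Implicit Defensive.
Import Order.TTheory GRing.Theory Num.Theory.
Import numFieldNormedType.Exports.
Local Open Scope classical_set_scope.
Local Open Scope ring_scope.

Definition span (R : realType) (V : normedModType R) (e : nat -> V) : set V :=
  [set x | exists (N : nat) (a : nat -> R), x = \sum_(i < N) a i *: e i].

Definition closed_span (R : realType) (V : normedModType R) (e : nat -> V) : set V :=
  closure (span e).

Definition expands_to (R : realType) (V : normedModType R) (e : nat -> V)
  (c : nat -> R) (x : V) : Prop :=
  (fun n => \sum_(i < n) c i *: e i) @ \oo --> x.

Definition basic_seq (R : realType) (V : normedModType R) (e : nat -> V) : Prop :=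
  forall x, closed_span e x -> exists! c : nat -> R, expands_to e c x.

Definition normalized (R : realType) (V : normedModType R) (e : nat -> V) : Prop :=
  forall i, `|e i| = 1.

Definition unconditional_basic (R : realType) (V : normedModType R) (e : nat -> V) : Prop :=
  basic_seq e /\
  forall x (c : nat -> R), closed_span e x -> expands_to e c x ->
    forall pi : nat -> nat, bijective pi ->
      (fun n => \sum_(i < n) c (pi i) *: e (pi i)) @ \oo --> x.

Definition dominates (R : realType) (V W : normedModType R) (x : nat -> V) (y : nat -> W) : Prop :=
  exists C : R, forall (N : nat) (a : nat -> R),
    `|\sum_(i < N) a i *: y i| <= C * `|\sum_(i < N) a i *: x i|.

(* right dominant (indices start at 0; m 0 <= n 0 < m 1 <= n 1 < ...;
   the coefficient b i plays the role of a_{n(i)}) *)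
Definition right_dominant (R : realType) (V : normedModType R) (e : nat -> V) : Prop :=
  unconditional_basic e /\
  exists D : R, forall m n : nat -> nat,
    (forall i, (m i <= n i)%N /\ (n i < m i.+1)%N) ->
    forall (N : nat) (b : nat -> R),
      `|\sum_(i < N) b i *: e (m i)| <= D * `|\sum_(i < N) b i *: e (n i)|.

Definition is_block_basis (R : realType) (V : normedModType R) (e y : nat -> V) : Prop :=
  exists (p : nat -> nat) (c : nat -> R),
    (forall k, (p k < p k.+1)%N) /\
    (forall k, y k = \sum_(p k <= j < p k.+1) c j *: e j) /\
    (forall k, y k != 0).

Definition dominates_normalized_block_bases (R : realType) (V : normedModType R)
  (e : nat -> V) : Prop :=
  forall y : nat -> V, is_block_basis e y -> normalized y -> dominates e y.

(* (e_i) dominates (e_i'), e_i' the biorthogonal functionals in [e_i]':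
   || sum a_i e_i' ||_{[e_i]'} = sup_{x in [e_i], ||x|| <= 1} |sum a_i e_i'(x)|,
   and e_i'(x) = c_i where x = sum_i c_i e_i is the (unique) expansion of x. *)
Definition dominates_biorthogonals (R : realType) (V : normedModType R) (e : nat -> V) : Prop :=
  exists C : R, forall (N : nat) (a : nat -> R) (c : nat -> R) (x : V),
    expands_to e c x ->
    `|\sum_(i < N) a i * c i| <= C * `|\sum_(i < N) a i *: e i| * `|x|.

Definition Jnorm_cands (R : realType) (V : normedModType R) (e : nat -> V)
  (a : nat -> R) : set R :=
  [set r | exists (k : nat) (p : nat -> nat),
     (0 < k)%N /\ p 0%N = 0%N /\ (forall i, (i < k)%N -> (p i < p i.+1)%N) /\
     r = `|\sum_(i < k) (\sum_(p i <= j < p i.+1) a j) *: e (p i)|].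

Definition is_lub (R : realType) (S : set R) (r : R) : Prop :=
  (forall s, S s -> s <= r) /\ (forall r', (forall s, S s -> s <= r') -> r <= r').

(* J is (isometric to) J(e_i): a Banach space with vectors u_i whose span is
   dense and whose norm on finite combinations is the sup formula. This
   characterizes the completion up to isometric isomorphism. *)
Definition is_J_space (R : realType) (V : normedModType R) (e : nat -> V)
  (J : normedModType R) (u : nat -> J) : Prop :=
  closure (span u) = setT /\
  forall (N : nat) (a : nat -> R), (forall j, (N <= j)%N -> a j = 0) ->
    is_lub (Jnorm_cands e a) `|\sum_(i < N) a i *: u i|.

Definition closed_subspace (R : realType) (J : normedModType R) (E : set J) : Prop :=
  closed E /\ E 0 /\ (forall x y, E x -> E y -> E (x + y)) /\
  (forall (l : R) x, E x -> E (l *: x)).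

Definition bounded_op_to_dual (R : realType) (J : normedModType R) (E : set J)
  (T : J -> J -> R) : Prop :=
  (forall x, E x -> forall (l : R) y z, T x (l *: y + z) = l * T x y + T x z) /\
  (forall x x' (l : R), E x -> E x' -> forall y, T (l *: x + x') y = l * T x y + T x' y) /\
  (exists C : R, forall x y, E x -> `|T x y| <= C * `|x| * `|y|).

Definition compact_op_to_dual (R : realType) (J : normedModType R) (E : set J)
  (T : J -> J -> R) : Prop :=
  forall (x : nat -> J) (B : R), (forall n, E (x n)) -> (forall n, `|x n| <= B) ->
    exists (phi : nat -> nat) (f : J -> R),
      (forall n, (phi n < phi n.+1)%N) /\
      (forall (l : R) y z, f (l *: y + z) = l * f y + f z) /\
      (exists M : R, forall y, `|f y| <= M * `|y|) /\
      (forall eps : R, 0 < eps -> exists n0 : nat, forall n, (n0 <= n)%N ->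
         forall y, `|y| <= 1 -> `|T (x (phi n)) y - f y| <= eps).

(* Main.v *)
(** If [e] dominates its biorthogonals, then pairing coordinates gives a bounded
bilinear form on [J] sending [(u_i, u_j)] to [delta_ij], hence a noncompact operator.

Conversely, let [T] be a noncompact operator from [E] to the dual of [J].  Taking
differences of a bounded sequence whose coefficients and total sums converge, one
finds [z_k] in [E] close to block vectors of [u] with zero total sum, and unit
vectors [y_k] with [T z_k y_k] bounded below.  Such a sequence [z] satisfies an upper
[e]-estimate: in the [J]-norm an interval either starts inside a block, which
contributes a block vector of [e], or ends inside a block in which it does not start,
and then right dominance moves its left end into that block.  Unless [e] is
equivalent to the [l1] basis, [T z_k y] tends to [0] for every [y], so the [y_k] can be
replaced by differences enjoying the same upper estimate.  A choice of signs bounds the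
diagonal [sum_n b_n c_n T z_n w_n] by [|T| |sum_n b_n z_n| |sum_n c_n w_n|] up to a
constant, so [e] dominates its biorthogonals. *)
Require Import Defs.
From HB Require Import structures.
From mathcomp Require Import all_boot all_order all_algebra.
From mathcomp Require Import all_classical all_reals all_analysis.
From mathcomp Require Import zify ring lra.
Set Implicit Arguments.
Unset Strict Implicit.
Unset Printing Implicit Defensive.
Import Order.TTheory GRing.Theory Num.Theory.
Import numFieldNormedType.Exports.
Local Open Scope classical_set_scope.
Local Open Scope ring_scope.

(** The hypotheses are qualitative, so uniform constants have to be manufactured. Unconditionality
    is given by rearrangements and basicness by uniqueness of expansions; a Baire argument extracts
    a multiplier constant [K] from them. Domination of block bases has its own constant for each
    block basis; a gluing argument yields one valid for all families in given blocks. This second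
    uniformity is what the norm of [J] demands: its supremum runs over all partitions, and each
    partition cuts a fixed sequence of [J] into a different family of block vectors of [e].

    Zero total sum makes an interval that covers a whole block contribute nothing. Differences are
    taken because the total sum is a functional of norm at most 1 on [J], which need not be small
    along a bounded sequence. The [l1] case is harmless: coordinates are uniformly bounded, so an
    [e] dominating the [l1] basis dominates its biorthogonals. A functional staying away from 0
    along a sequence with an upper [e]-estimate would force exactly that case. The signs come from
    averaging: the mean over all signs of the double sum is its diagonal. *)

Section Sequences.
Context {R : realType}.
Implicit Types (V : normedModType R).

(** * Sequences, subsequences and the diagonal argument *)

Lemma cvg_seqP V (x : nat -> V) (l : V) :
  x @ \oo --> l <->
  forall eps : R, 0 < eps ->
    exists n0 : nat, forall n, (n0 <= n)%N -> `|l - x n| <= eps.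
Proof.
split=> [/cvgrPdist_le xl eps eps0|xl].
  by have [n0 _ h] := xl eps eps0; exists n0 => n /h.
by apply/cvgrPdist_le => eps /xl[n0 h]; exists n0.
Qed.

Lemma cauchy_seq_cvg (X : completeNormedModType R) (x : nat -> X) :
  (forall eps : R, 0 < eps -> exists n0 : nat, forall n m,
    (n0 <= n)%N -> (n0 <= m)%N -> `|x n - x m| <= eps) ->
  exists l, forall eps : R, 0 < eps ->
    exists n0 : nat, forall n, (n0 <= n)%N -> `|l - x n| <= eps.
Proof.
move=> xC; suff : cvgn x by move=> /cvg_ex[l /cvg_seqP xl]; exists l.
apply/cauchy_cvgP/cauchy_exP => eps eps0.
have [|n0 h] := xC (eps / 2); first by rewrite divr_gt0.
exists (x n0); exists n0 => // m n0m; rewrite -ball_normE /=.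
by rewrite (le_lt_trans (h _ _ (leqnn _) n0m))// ltr_pdivrMr// ltr_pMr// ltr1n.
Qed.

Lemma norm_le_lim V (x : nat -> V) (l : V) (M : R) :
  x @ \oo --> l -> (forall n, `|x n| <= M) -> `|l| <= M.
Proof.
move=> /cvg_seqP xl xM; apply/ler_addgt0Pr => eps /xl[n0 /(_ n0 (leqnn _)) h].
rewrite -(subrK (x n0) l) (le_trans (ler_normD _ _))// addrC lerD//.
Qed.

Lemma geom_small (eps M : R) : 0 < eps ->
  exists n0 : nat, forall n, (n0 <= n)%N -> M * 2^-1 ^+ n <= eps.
Proof.
move=> eps0.
have h : geometric M (2^-1 : R) @ \oo --> (0 : R).
  by apply: cvg_geometric; rewrite ger0_norm ?invr_ge0// invf_lt1// ltr1n.
have [n0 hn] := (cvg_seqP _ _).1 h _ eps0.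
exists n0 => n /hn; rewrite sub0r normrN; apply: le_trans; exact: ler_norm.
Qed.

Lemma increasing_leq (q : nat -> nat) : (forall k, (q k < q k.+1)%N) ->
  forall m n, (m <= n)%N -> (q m <= q n)%N.
Proof.
move=> qS m; elim=> [|n IH]; first by rewrite leqn0 => /eqP->.
rewrite leq_eqVlt => /orP[/eqP->//|]; rewrite ltnS => /IH h.
exact: leq_trans h (ltnW (qS n)).
Qed.

Lemma increasing_ge_id (q : nat -> nat) : (forall k, (q k < q k.+1)%N) ->
  forall n, (n <= q n)%N.
Proof. by move=> qS; elim=> [//|n IH]; apply: leq_ltn_trans IH (qS n). Qed.

Lemma block_index (q : nat -> nat) :
  q 0%N = 0%N -> (forall k, (q k < q k.+1)%N) ->
  exists blk : nat -> nat,
    (forall j, (q (blk j) <= j < q (blk j).+1)%N) /\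
    (forall j k, (q k <= j < q k.+1)%N -> blk j = k).
Proof.
move=> q0 qS.
have ex j : exists k, (q k <= j < q k.+1)%N.
  elim: j => [|j [k /andP[h1 h2]]].
    by exists 0%N; have := qS 0%N; rewrite q0; lia.
  have [h|h] := ltnP j.+1 (q k.+1); first by exists k; rewrite h (leq_trans h1).
  exists k.+1; rewrite h /=; have := qS k.+1; lia.
have [blk hblk] := choice ex.
exists blk; split=> // j k /andP[h1 h2].
have /andP[h3 h4] := hblk j.
have [h|h|//] := ltngtP (blk j) k.
- have := increasing_leq qS h; lia.
- have := increasing_leq qS h; lia.
Qed.

Lemma extract_subseq (P : nat -> nat -> Prop) :
  (forall k N, exists n, (N <= n)%N /\ P k n) ->
  exists phi : nat -> nat,
    (forall k, (phi k < phi k.+1)%N) /\ forall k, P k (phi k).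
Proof.
move=> PE.
have /choice[f hf] : forall kN : nat * nat, exists n, (kN.2 <= n)%N /\ P kN.1 n.
  by move=> [k N]; exact: PE.
pose fix phi k := if k is k'.+1 then f (k, (phi k').+1) else f (0%N, 0%N).
exists phi; split=> [k|[|k]] /=.
- exact: (hf (k.+1, (phi k).+1)).1.
- exact: (hf (0%N, 0%N)).2.
- exact: (hf (k.+1, (phi k).+1)).2.
Qed.

(** An ultrafilter finer than the filter at infinity gives every row a limit at once, by compactness
    of a segment. A subsequence is then read off by constraining at stage [k] only the rows up to
    [k], with precision [2^-k]. *)
Lemma diagonal_subseq (h : nat -> nat -> R) (M : nat -> R) :
  (forall i n, `|h i n| <= M i) ->
  exists phi : nat -> nat, (forall k, (phi k < phi k.+1)%N) /\
    forall i (eps : R), 0 < eps -> exists n0 : nat, forall n m,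
      (n0 <= n)%N -> (n0 <= m)%N -> `|h i (phi n) - h i (phi m)| <= eps.
Proof.
move=> hM.
have [U [UU subU]] := @ultraFilterLemma nat (nbhs \oo) _.
have UF : ProperFilter U by exact: ultra_proper.
have /choice[L hL] : forall i, exists l : R, forall eps, 0 < eps ->
    U [set n | `|l - h i n| <= eps].
  move=> i; have Uh : (h i @ U) `[(- M i), (M i)]%classic.
    apply: (@filterS _ U _ setT) filterT => n _ /=.
    by rewrite in_itv /= -ler_norml.
  have /(_ _ _ Uh)[l [_ hl]] := @segment_compact R (- M i) (M i).
  exists l => eps eps0.
  have [//|UC] := in_ultra_setVsetC [set n | `|l - h i n| <= eps] UU.
  have [] := hl (h i @` ~` [set n | `|l - h i n| <= eps]) (ball l eps).
  - by rewrite /nbhs /=; apply: filterS UC => n Hn; exists n.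
  - exact: nbhsx_ballx.
  by move=> _ [[n nle <-]]; rewrite -ball_normE /= => /ltW /nle.
have [k N|phi [phiS hphi]] := @extract_subseq
    (fun k n => forall i, (i <= k)%N -> `|L i - h i n| <= 2^-1 ^+ k) .
  (* [U] contains all tails and is stable under finite intersections, so the finitely many
     constraints of stage [k] are met by some index beyond [N]. *)
  have UN : U [set n | (N <= n)%N] by apply: subU; exists N.
  suff : U [set n | forall i, (i <= k)%N -> `|L i - h i n| <= 2^-1 ^+ k].
    by move=> Uk; have [n [? ?]] := filter_ex (filterI UN Uk); exists n.
  have pos : 0 < 2^-1 ^+ k :> R by rewrite exprn_gt0// invr_gt0.
  suff H j : U [set n | forall i, (i < j)%N -> `|L i - h i n| <= 2^-1 ^+ k].
    by apply: filterS (H k.+1) => n hn i ik; apply: hn; rewrite ltnS.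
  elim: j => [|j IH]; first by apply: (@filterS _ U _ setT) filterT.
  have hj := hL j _ pos.
  apply: filterS (filterI IH hj) => n [h1 h2] i.
  by rewrite ltnS leq_eqVlt => /orP[/eqP->//|]; exact: h1.
exists phi; split=> // i eps eps0.
have [n0 hn0] := @geom_small _ 2 eps0.
exists (maxn i n0) => n m; rewrite !geq_max => /andP[ni nn0] /andP[mi mn0].
rewrite -(subrK (L i) (h i (phi n))) -addrA (le_trans (ler_normD _ _))//.
have := hphi n i ni; have := hphi m i mi; have := hn0 _ nn0; have := hn0 _ mn0.
rewrite [`|h i _ - L i|]distrC; lra.
Qed.

End Sequences.

(** * Partial sums, closed spans and expansions *)

Section PartialSums.
Context {R : realType} {V : normedModType R} (e : nat -> V).
Implicit Types (A : pred nat) (c d : nat -> R) (m n : nat) (x y : V).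

(** The predicate encodes coordinate projections; their boundedness is the form in which
    unconditionality is first obtained. *)
Definition psum (A : pred nat) (c : nat -> R) (n : nat) : V :=
  \sum_(i < n | A i) c i *: e i.

Lemma psumD A c d n : psum A (fun i => c i + d i) n = psum A c n + psum A d n.
Proof. by rewrite -big_split; apply: eq_bigr => i _; rewrite scalerDl. Qed.

Lemma psumZ A l c n : psum A (fun i => l * c i) n = l *: psum A c n.
Proof. by rewrite scaler_sumr; apply: eq_bigr => i _; rewrite scalerA. Qed.

Lemma psumN A c n : psum A (fun i => - c i) n = - psum A c n.
Proof. by rewrite -sumrN; apply: eq_bigr => i _; rewrite scaleNr. Qed.

Lemma psum_sum A (c : nat -> nat -> R) m n :
  psum A (fun i => \sum_(k < m) c k i) n = \sum_(k < m) psum A (c k) n.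
Proof.
by rewrite exchange_big; apply: eq_bigr => i _; rewrite scaler_suml.
Qed.

Lemma psumT c n : \sum_(i < n) c i *: e i = psum xpredT c n.
Proof. by []. Qed.

Lemma psum_nat A c n : psum A c n = \sum_(0 <= i < n | A i) c i *: e i.
Proof. by rewrite big_mkord. Qed.

Lemma psum_if A c n : psum A c n = psum xpredT (fun i => if A i then c i else 0) n.
Proof.
by rewrite /psum big_mkcond; apply: eq_bigr => i _; case: ifP => // _; rewrite scale0r.
Qed.

Lemma psum_widen c m n : (m <= n)%N -> (forall i, (m <= i)%N -> c i = 0) ->
  psum xpredT c n = psum xpredT c m.
Proof.
move=> mn c0; rewrite !psum_nat (big_cat_nat _ mn)//=.
rewrite [X in _ + X]big_nat_cond [X in _ + X]big1 ?addr0// => i.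
by rewrite andbT => /andP[/c0-> _]; rewrite scale0r.
Qed.

Lemma psum_trunc A c m n : (m <= n)%N ->
  psum A (fun i => if (i < m)%N then c i else 0) n = psum A c m.
Proof.
move=> mn; rewrite psum_if (@psum_widen _ m n)// => [|i mi].
  by rewrite [RHS]psum_if; apply: eq_bigr => i _; rewrite ltn_ord.
by rewrite ltnNge mi /=; case: ifP.
Qed.

Lemma spanP x : Defs.span e x <-> exists c n, x = psum xpredT c n.
Proof. by split=> [[n [c ->]]|[c [n ->]]]; [exists c, n|exists n, c]. Qed.

Lemma spanD x y : Defs.span e x -> Defs.span e y -> Defs.span e (x + y).
Proof.
move=> [m [c ->]] [n [d ->]]; rewrite !psumT.
rewrite -(psum_trunc _ c (leq_maxl m n)) -(psum_trunc _ d (leq_maxr m n)) -psumD.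
by apply/spanP; exists (fun i => (if (i < m)%N then c i else 0)
  + if (i < n)%N then d i else 0), (maxn m n).
Qed.

Lemma spanZ l x : Defs.span e x -> Defs.span e (l *: x).
Proof. by move=> [m [c ->]]; rewrite psumT -psumZ; apply/spanP; do 2!eexists. Qed.

Lemma closed_spanP x : closed_span e x <->
  forall eps : R, 0 < eps -> exists y, Defs.span e y /\ `|x - y| <= eps.
Proof.
split=> [+ eps eps0|H B /nbhs_ballP[eps /= eps0 epsB]].
  move=> /(_ _ (nbhsx_ballx x eps eps0))[y [sy]].
  by rewrite -ball_normE /= => /ltW; exists y.
have [|y [sy hy]] := H (eps / 2); first by rewrite divr_gt0.
exists y; split=> //; apply: epsB; rewrite -ball_normE /=.
by apply: le_lt_trans hy _; rewrite ltr_pdivrMr// ltr_pMr// ltr1n.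
Qed.

Lemma closed_spanD x y : closed_span e x -> closed_span e y -> closed_span e (x + y).
Proof.
move=> /closed_spanP hx /closed_spanP hy; apply/closed_spanP => eps eps0.
have e2 : 0 < eps / 2 by rewrite divr_gt0.
have [a [sa ha]] := hx _ e2; have [b [sb hb]] := hy _ e2.
exists (a + b); split; first exact: spanD.
by rewrite opprD addrACA (le_trans (ler_normD _ _))// [leRHS]splitr lerD.
Qed.

Lemma closed_spanZ l x : closed_span e x -> closed_span e (l *: x).
Proof.
move=> /closed_spanP hx; apply/closed_spanP => eps eps0.
have l0 : 0 < `|l| + 1 by rewrite ltr_wpDl.
have [|a [sa ha]] := hx (eps / (`|l| + 1)); first by rewrite divr_gt0.
exists (l *: a); split; first exact: spanZ.
rewrite -scalerBr normrZ (@le_trans _ _ ((`|l| + 1) * `|x - a|))//.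
  by rewrite ler_wpM2r// lerDl.
by rewrite mulrC -ler_pdivlMr.
Qed.

Lemma closed_spanB x y : closed_span e x -> closed_span e y -> closed_span e (x - y).
Proof.
by move=> hx hy; rewrite -scaleN1r; apply: closed_spanD => //; exact: closed_spanZ.
Qed.

Lemma closed_span_lim x :
  (forall eps : R, 0 < eps -> exists y, closed_span e y /\ `|x - y| <= eps) ->
  closed_span e x.
Proof.
move=> h; apply/closed_spanP => eps eps0.
have e2 : 0 < eps / 2 by rewrite divr_gt0.
have [y [/closed_spanP/(_ _ e2)[z [sz hz]] hy]] := h _ e2.
exists z; split=> //; rewrite -(subrK y x) -addrA (le_trans (ler_normD _ _))//.
by rewrite [leRHS]splitr lerD.
Qed.

Lemma span_closed_span x : Defs.span e x -> closed_span e x.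
Proof. exact: subset_closure. Qed.

Lemma expands_closed_span c x : expands_to e c x -> closed_span e x.
Proof.
move=> /cvg_seqP h; apply/closed_spanP => eps /h[n0 hn].
by exists (psum xpredT c n0); split; [apply/spanP; exists c, n0|exact: hn].
Qed.

Lemma expands_psum c n :
  expands_to e (fun i => if (i < n)%N then c i else 0) (psum xpredT c n).
Proof.
apply/cvg_seqP => eps eps0; exists n => m nm.
rewrite -[X in _ - X]/(psum xpredT (fun i => if (i < n)%N then c i else 0) m).
by rewrite psum_trunc// subrr normr0 ltW.
Qed.

Lemma expandsD c d x y : expands_to e c x -> expands_to e d y ->
  expands_to e (fun i => c i + d i) (x + y).
Proof.
move=> hx hy; rewrite /expands_to (_ : (fun n => _) =
  (fun n => psum xpredT c n) \+ (fun n => psum xpredT d n)).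
  exact: cvgD.
by apply/funext => n; exact: psumD.
Qed.

Lemma expandsZ c x l : expands_to e c x -> expands_to e (fun i => l * c i) (l *: x).
Proof.
move=> hx; rewrite /expands_to (_ : (fun n => _) = (fun n => l *: psum xpredT c n)).
  exact: cvgZr.
by apply/funext => n; exact: psumZ.
Qed.

Lemma psum_cvg A (d : nat -> nat -> R) (c : nat -> R) n :
  (forall i, (fun m => d m i) @ \oo --> c i) ->
  (fun m => psum A (d m) n) @ \oo --> psum A c n.
Proof.
move=> dc; elim: n => [|n IH].
  rewrite (_ : (fun=> _) = fun=> 0) /psum ?big_ord0; first exact: cvg_cst.
  by apply/funext => m; rewrite /psum big_ord0.
rewrite /psum big_mkcond big_ord_recr /= -big_mkcond /=.
rewrite (_ : (fun=> _) = (fun m => psum A (d m) n) \+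
    (fun m => if A n then d m n *: e n else 0)).
  apply: cvgD => //; case: ifP => _; last exact: cvg_cst.
  by apply: cvgZl.
by apply/funext => m; rewrite /psum big_mkcond big_ord_recr /= -big_mkcond.
Qed.

End PartialSums.

(** * From rearrangements to a multiplier constant *)

Section Rearrangement.
Context {R : realType} {V : normedModType R}.

(* Otherwise consecutive index blocks contain subsets with sums of norm at least 1, and
   listing these subsets first within each block gives a divergent rearrangement. *)
Lemma rearrangement_bounded (F : nat -> V) (x : V) :
  (forall pi : nat -> nat, bijective pi ->
    (fun n => \sum_(i < n) F (pi i)) @ \oo --> x) ->
  exists M : R, forall (A : pred nat) n, `|\sum_(i < n | A i) F i| <= M.
Proof.
move=> Fpi; apply: contrapT => /forallNP H.
have head_le m n (A : pred nat) : (n <= m)%N ->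
    `|\sum_(0 <= i < n | A i) F i| <= \sum_(0 <= i < m) `|F i|.
  move=> nm; rewrite (le_trans (ler_norm_sum _ _ _))// [leRHS](big_cat_nat _ nm)//=.
  rewrite ler_wpDr ?sumr_ge0// big_mkcond ler_sum// => i _.
  by case: ifP.
have /choice[f hf] : forall m : nat, exists nA : nat * pred nat, (m < nA.1)%N /\
    1 <= `|\sum_(m <= i < nA.1 | nA.2 i) F i|.
  (* The threshold exceeds by 1 whatever the terms below [m] can contribute, so the part of the sum
     from [m] on keeps norm at least 1. *)
  move=> m; have /existsNP[A /existsNP[n /negP]] := H (1 + \sum_(0 <= i < m) `|F i|).
  rewrite -ltNge -(big_mkord A F) => hn.
  have [nm|mn] := leqP n m.
    by have := lt_le_trans hn (head_le _ _ A nm); rewrite gtrDr ltr10.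
  exists (n, A); split=> //=; move: hn; rewrite (big_cat_nat _ (ltnW mn))//=.
  have := head_le m m A (leqnn m).
  have := ler_normD (\sum_(0 <= i < m | A i) F i) (\sum_(m <= i < n | A i) F i).
  lra.
pose q k := iter k (fun m => (f m).1) 0%N.
pose A k := (f (q k)).2.
have qS k : (q k < q k.+1)%N by exact: (hf (q k)).1.
have [blk [blkP blkE]] := block_index erefl qS.
pose s k := [seq i <- index_iota (q k) (q k.+1) | A k i].
pose L k := s k ++ [seq i <- index_iota (q k) (q k.+1) | predC (A k) i].
have Lperm k : perm_eq (L k) (index_iota (q k) (q k.+1)) by exact/permPl/perm_filterC.
have Lmem k i : (i \in L k) = (q k <= i < q k.+1)%N.
  by rewrite (perm_mem (Lperm k)) mem_index_iota.
have Lsize k : size (L k) = (q k.+1 - q k)%N.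
  by rewrite (perm_size (Lperm k)) size_iota.
have Luniq k : uniq (L k) by rewrite (perm_uniq (Lperm k)) iota_uniq.
(* [L k] only permutes block [k], so [pi] preserves blocks and is inverted by looking up a position
   in the list. *)
pose pi j := nth 0%N (L (blk j)) (j - q (blk j)).
pose inv i := (q (blk i) + index i (L (blk i)))%N.
have offs j : (j - q (blk j) < size (L (blk j)))%N.
  by rewrite Lsize; have := blkP j; lia.
have blk_pi j : blk (pi j) = blk j.
  by apply: blkE; rewrite -Lmem; exact: mem_nth.
have blk_inv i : blk (inv i) = blk i.
  apply: blkE; have : (index i (L (blk i)) < size (L (blk i)))%N.
    by rewrite index_mem Lmem.
  by rewrite Lsize /inv; have := qS (blk i); lia.
(* The rearranged partial sums of lengths [q n0] and [q n0 + size (s n0)] lie within 1/4 of [x], yet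
   they differ by the selected sum of block [n0], of norm at least 1. *)
have /Fpi/cvg_seqP/(_ 4^-1)[|n0 hn0] : bijective pi.
- exists inv => [j|i].
    rewrite /inv blk_pi index_uniq//.
    by have /andP[h _] := blkP j; rewrite subnKC.
  by rewrite /pi blk_inv /inv addKn nth_index// Lmem.
- by rewrite invr_gt0.
pose t := (q n0 + size (s n0))%N.
have hq : (n0 <= q n0)%N by exact: increasing_ge_id.
have qt : (q n0 <= t)%N by rewrite leq_addr.
have := (hf (q n0)).2.
suff -> : \sum_(q n0 <= i < (f (q n0)).1 | (f (q n0)).2 i) F i =
    \sum_(i < t) F (pi i) - \sum_(i < q n0) F (pi i).
  have -> : \sum_(i < t) F (pi i) - \sum_(i < q n0) F (pi i) =
      (\sum_(i < t) F (pi i) - x) + (x - \sum_(i < q n0) F (pi i)).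
    by rewrite addrA subrK.
  move: (ler_normD (\sum_(i < t) F (pi i) - x) (x - \sum_(i < q n0) F (pi i))).
  have := hn0 _ (leq_trans hq qt); have := hn0 _ hq.
  rewrite [`|x - \sum_(i < t) _|]distrC; lra.
rewrite -!(big_mkord xpredT (fun i => F (pi i))) (big_cat_nat _ qt)//= [RHS]addrC addKr.
rewrite -[in RHS](add0n (q n0)) big_addn /t addKn -big_filter -/(s n0).
rewrite (big_nth 0%N) big_nat [RHS]big_nat; apply: eq_bigr => i /andP[_ it].
have ib : (i < q n0.+1 - q n0)%N by rewrite -Lsize size_cat (leq_trans it)// leq_addr.
have bi : blk (i + q n0)%N = n0. 
  apply: (blkE (i + q n0)%N n0); apply/andP; split; first exact: leq_addl.
  by rewrite addnC -ltn_subRL.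
by rewrite /pi bi addnK nth_cat it.
Qed.

End Rearrangement.

Section GeometricSeries.
Context {R : realType} {X : completeNormedModType R}.

Lemma geometric_dist (s : nat -> X) (B : R) :
  (forall k, `|s k.+1 - s k| <= B * 2^-1 ^+ k) ->
  forall m n, (m <= n)%N -> `|s n - s m| <= 2 * B * 2^-1 ^+ m.
Proof.
move=> sB m n mn.
have B0 : 0 <= B by have := sB 0%N; rewrite expr0 mulr1; apply: le_trans.
(* Subtracting the remaining tail of the geometric series makes the bound stable under the
   induction. *)
suff : `|s n - s m| <= 2 * B * 2^-1 ^+ m - 2 * B * 2^-1 ^+ n.
  by move=> /le_trans; apply; rewrite gerBl ?mulr_ge0// exprn_ge0.
rewrite -(subnKC mn); elim: (n - m)%N => [|k IH].
  by rewrite addn0 !subrr normr0.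
rewrite addnS -(subrK (s (m + k)%N) (s _)) -addrA (le_trans (ler_normD _ _))//.
have := sB (m + k)%N; rewrite exprS; move: IH; lra.
Qed.

Lemma geometric_cvg (s : nat -> X) (B : R) :
  (forall k, `|s k.+1 - s k| <= B * 2^-1 ^+ k) -> exists l : X, s @ \oo --> l.
Proof.
move=> sB; have sd := geometric_dist sB.
have [|l hl] := @cauchy_seq_cvg _ _ s; last by exists l; apply/cvg_seqP.
move=> eps eps0; have [n0 hn0] := geom_small (2 * B) eps0.
exists n0 => n m nn nm.
have [mn|/ltnW mn] := leqP m n.
  exact: le_trans (sd _ _ mn) (hn0 _ nm).
by rewrite distrC; exact: le_trans (sd _ _ mn) (hn0 _ nn).
Qed.

End GeometricSeries.

Section OpenMapping.
Context {R : realType} {X : completeNormedModType R} (e : nat -> X).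

(** These are the balls of the stronger norm that takes the supremum over all coordinate projections
    of an expansion. Comparing it with the norm of [X], as in the open mapping theorem, gives the
    unconditional constant. *)
Definition expansion_bounded (M : R) (x : X) :=
  exists c, expands_to e c x /\ forall (A : pred nat) n, `|psum e A c n| <= M.

Lemma expansion_boundedD M N x y : expansion_bounded M x ->
  expansion_bounded N y -> expansion_bounded (M + N) (x + y).
Proof.
move=> [c [cx cM]] [d [dy dN]]; exists (fun i => c i + d i).
split=> [|A n]; first exact: expandsD.
by rewrite psumD (le_trans (ler_normD _ _))// lerD.
Qed.

Lemma expansion_boundedZ M x l :
  expansion_bounded M x -> expansion_bounded (`|l| * M) (l *: x).
Proof.
move=> [c [cx cM]]; exists (fun i => l * c i); split=> [|A n]; first exact: expandsZ.
by rewrite psumZ normrZ ler_wpM2l.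
Qed.

Lemma expansion_bounded_ge0 M x : expansion_bounded M x -> 0 <= M.
Proof. by move=> [c [_ /(_ xpredT 0%N)]]; apply: le_trans. Qed.

Lemma expansion_bounded0 : expansion_bounded 0 0.
Proof.
have p0 A n : psum e A (fun=> 0) n = 0 by apply: big1 => i _; rewrite scale0r.
exists (fun=> 0); split=> [|A n]; last by rewrite p0 normr0.
apply/cvg_seqP => eps eps0; exists 0%N => n _.
by rewrite -[X in _ - X]/(psum e xpredT (fun=> 0) n) p0 subrr normr0 ltW.
Qed.

Lemma expansion_bounded_span M x : expansion_bounded M x -> closed_span e x.
Proof. by move=> [c [/expands_closed_span]]. Qed.

(** Baire's argument made explicit: if no level were dense in a ball of the closed span, nested
    balls could be chosen so that the one built at step [m] avoids all vectors of level [m], and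
    their common point would have no bounded expansion. *)
Lemma expansion_baire :
  (forall x, closed_span e x -> exists M, expansion_bounded M x) ->
  exists M x0 r, [/\ 0 < r, closed_span e x0 &
    forall x, closed_span e x -> `|x - x0| <= r ->
      forall eps, 0 < eps -> exists y, expansion_bounded M y /\ `|x - y| <= eps].
Proof.
move=> bdd; apply: contrapT => H.
(* [f] maps a level and a ball to a ball of at most half the radius that avoids this level. The
   default value serves only when the center is outside the closed span or the radius is not
   positive. *)
have /choice[f hf] : forall mxr : nat * (X * R), exists yr : X * R,
    closed_span e mxr.2.1 -> 0 < mxr.2.2 ->
    [/\ closed_span e yr.1, 0 < yr.2 <= mxr.2.2 / 2, `|yr.1 - mxr.2.1| <= mxr.2.2 / 2 &
        forall y, expansion_bounded mxr.1%:R y -> yr.2 < `|yr.1 - y|].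
  move=> [m [x r]] /=; have [[sx r0]|] := EM (closed_span e x /\ 0 < r); last first.
    by move=> ?; exists (x, r) => ? ?; exfalso; tauto.
  apply: contrapT => /forallNP H'; apply: H.
  exists m%:R, x, (r / 2); split=> //; first by rewrite divr_gt0.
  move=> z sz zx eps eps0; apply: contrapT => /forallNP H''.
  apply: (H' (z, Num.min eps (r / 2))) => _ _; split=> //=.
    by rewrite lt_min eps0 divr_gt0//= ge_min lexx orbT.
  move=> y gy; have := H'' y => /not_andP[//|/negP]; rewrite -ltNge.
  by apply: le_lt_trans; rewrite ge_min lexx.
pose st m := nat_rect (fun=> (X * R)%type) (0, 1) (fun m xr => f (m, xr)) m.
have st_ok m : closed_span e (st m).1 /\ 0 < (st m).2.
  elim: m => [|m [IH1 IH2]] /=; last first.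
    by have [? /andP[? _] _ _] := hf (m, st m) IH1 IH2.
  by split=> //; apply: span_closed_span; exists 0%N, (fun=> 0); rewrite big_ord0.
have stS m := hf (m, st m) (st_ok m).1 (st_ok m).2.
have st_le m : (st m).2 <= 2^-1 ^+ m.
  elim: m => [|m IH] //=; have [_ /andP[_ h] _ _] := stS m.
  by rewrite (le_trans h)// exprS mulrC ler_wpM2l// invr_ge0.
have st_dist m n : (m <= n)%N -> `|(st n).1 - (st m).1| <= (st m).2 - (st n).2.
  move=> mn; rewrite -(subnKC mn); elim: (n - m)%N => [|k IH].
    by rewrite addn0 !subrr normr0.
  rewrite addnS -(subrK (st (m + k)%N).1 (st _).1) -addrA (le_trans (ler_normD _ _))//.
  have [_ /andP[_ h1] h2 _] := stS (m + k)%N; move: IH h1 h2 => /=; lra.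
have st_near m n : (m <= n)%N -> `|(st n).1 - (st m).1| <= (st m).2.
  move=> /st_dist /le_trans; apply; rewrite gerBl ltW//; exact: (st_ok n).2.
have [|x hx] := @cauchy_seq_cvg _ _ (fun m => (st m).1).
  move=> eps eps0; have [n0 hn0] := geom_small 1 eps0.
  exists n0 => n m nn nm; have [mn|/ltnW mn] := leqP m n; [|rewrite distrC];
    by rewrite (le_trans (st_near _ _ mn))// (le_trans (st_le _))// -[leLHS]mul1r hn0.
have sx : closed_span e x.
  apply: closed_span_lim => eps /hx[n0 h]; exists (st n0).1.
  by split; [exact: (st_ok n0).1|exact: h].
have [M [c [cx cM]]] := bdd x sx.
have [m hm] : exists m : nat, M <= m%:R.
  exists (Num.truncn M).+1; apply: ltW; exact: truncnS_gt.
have gx : expansion_bounded m%:R x.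
  by exists c; split=> // A n; exact: le_trans (cM A n) hm.
have [_ _ _ /(_ x gx)] := stS m; rewrite ltNge => /negP; apply.
apply/ler_addgt0Pr => eps /hx[n0 h].
have := h (maxn n0 m.+1) (leq_maxl _ _).
have := st_near m.+1 (maxn n0 m.+1) (leq_maxr _ _).
set z := (st (maxn _ _)).1 => h1 h2.
rewrite -(subrK z (f _).1) -addrA (le_trans (ler_normD _ _))// lerD//.
  by rewrite distrC.
by rewrite distrC.
Qed.

(** Density near [x0] is moved to the origin by subtracting an approximation of [x0] from one of
    [x0 + l *: x], where [l] scales [x] to norm [r]; dividing by [l] makes it homogeneous. Two
    errors of [r / 4] become half the norm of [x], and two bounds [M] give the factor
    [2 * M / r]. *)
Lemma expansion_approx :
  (forall x, closed_span e x -> exists M, expansion_bounded M x) ->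
  exists2 M, 0 <= M & forall x, closed_span e x ->
    exists y, expansion_bounded (M * `|x|) y /\ `|x - y| <= `|x| / 2.
Proof.
move=> /expansion_baire[M [x0 [r [r0 sx0 H]]]].
have M0 : 0 <= M.
  have [|y [/expansion_bounded_ge0]//] := H x0 sx0 _ 1 ltr01.
  by rewrite subrr normr0 ltW.
exists (2 * M / r); first by rewrite divr_ge0 ?mulr_ge0// ltW.
move=> x sx; have [->|xn0] := eqVneq x 0.
  exists 0; rewrite subrr normr0 mulr0 mul0r; split=> //; exact: expansion_bounded0.
have nx : 0 < `|x| by rewrite normr_gt0.
pose l := r / `|x|; have l0 : 0 < l by rewrite divr_gt0.
have lx : `|l *: x| = r by rewrite normrZ gtr0_norm// divfK ?gt_eqF.
have [|||y [gy hy]] := H (x0 + l *: x) _ _ (r / 4).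
- by apply: closed_spanD => //; exact: closed_spanZ.
- by rewrite addrC addKr lx.
- by rewrite divr_gt0.
have [||z [gz hz]] := H x0 sx0 _ (r / 4).
- by rewrite subrr normr0 ltW.
- by rewrite divr_gt0.
exists (l^-1 *: (y + (-1) *: z)); split.
  have := expansion_boundedZ l^-1 (expansion_boundedD gy (expansion_boundedZ (-1) gz)).
  congr expansion_bounded; rewrite normrN1 ger0_norm ?invr_ge0 ?ltW// /l invf_div.
  by rewrite mul1r; ring.
rewrite -[x in `|x - _|](scalerK (lt0r_neq0 l0)) -scalerBr scaleN1r normrZ.
have -> : `|l^-1| = `|x| / r by rewrite ger0_norm ?invr_ge0 ?ltW// /l invf_div.
rewrite mulrAC ler_pdivrMr// -mulrA ler_pM2l//.
have -> : l *: x - (y - z) = (x0 + l *: x - y) - (x0 - z).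
  rewrite !opprB [x0 + _]addrC -!addrA; congr (_ + _).
  by rewrite [RHS]addrC !addrA subrK addrC.
by have := ler_normB (x0 + l *: x - y) (x0 - z); lra.
Qed.

(* Successive approximation, as in the open mapping theorem; uniqueness of expansions
   identifies the expansion so obtained. *)
Lemma expansion_constant : normalized e -> basic_seq e ->
  (forall x, closed_span e x -> exists M, expansion_bounded M x) ->
  exists K, forall x c, expands_to e c x ->
    forall (A : pred nat) n, `|psum e A c n| <= K * `|x|.
Proof.
move=> e1 eB /expansion_approx[M M0 H]; exists (2 * M) => x c0 c0x.
have sx : closed_span e x by exact: expands_closed_span c0x.
suff : expansion_bounded (2 * M * `|x|) x.
  move=> [c [cx cM]]; have [d [_ dE]] := eB x sx.
  by rewrite -(dE _ c0x) (dE _ cx).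
have /choice[a ha] : forall y, exists a, closed_span e y ->
    expansion_bounded (M * `|y|) a /\ `|y - a| <= `|y| / 2.
  by move=> y; have [/H[a ?]|] := EM (closed_span e y); [exists a|exists 0].
have /choice[cf hcf] : forall y, exists c, closed_span e y ->
    expands_to e c (a y) /\ forall (A : pred nat) n, `|psum e A c n| <= M * `|y|.
  move=> y; have [/ha[[c ?] _]|] := EM (closed_span e y); first by exists c.
  by exists (fun=> 0).
(* Residuals: each step removes an approximation of what is left, so the norms halve and the bounds
   on the pieces add up to the factor 2. *)
pose r k := iter k (fun y => y - a y) x.
have rs k : closed_span e (r k).
  elim: k => //= k IH; apply: closed_spanB => //.
  by have [/expansion_bounded_span] := ha _ IH.
have r_le k : `|r k| <= `|x| * 2^-1 ^+ k.
  elim: k => [|k IH] /=; first by rewrite expr0 mulr1.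
  have [_ h] := ha _ (rs k); rewrite (le_trans h)// exprSr mulrA ler_wpM2r//.
pose c k := cf (r k).
have cP k : forall (A : pred nat) n, `|psum e A (c k) n| <= M * `|x| * 2^-1 ^+ k.
  move=> A n; rewrite -mulrA (le_trans ((hcf _ (rs k)).2 A n))// ler_wpM2l//.
have sum_a m : x - r m = \sum_(k < m) a (r k).
  elim: m => [|m IH]; first by rewrite big_ord0 subrr.
  by rewrite big_ord_recr /= -IH opprB addrA addrAC.
pose d m i := \sum_(k < m) c k i.
have dS A n m : psum e A (d m.+1) n - psum e A (d m) n = psum e A (c m) n.
  by rewrite /d !psum_sum big_ord_recr addrAC subrr add0r.
have /choice[C hC] : forall i, exists l : R^o, (fun m => d m i : R^o) @ \oo --> l.
  move=> i; apply: (@geometric_cvg R _ _ (M * `|x|)) => k.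
  (* Projecting onto the single index [i] bounds the coefficient itself, because [e] is
     normalized. *)
  have := cP k (pred1 i) i.+1; rewrite /d big_ord_recr addrAC subrr add0r.
  rewrite psum_nat big_mkord (big_pred1 ord_max) => [|j]; last by rewrite /= -val_eqE.
  by rewrite /= normrZ e1 mulr1.
have dC A n : (fun m => psum e A (d m) n) @ \oo --> psum e A C n.
  by apply: psum_cvg => i; exact: hC.
have d_near A n m : `|psum e A C n - psum e A (d m) n| <= 2 * (M * `|x|) * 2^-1 ^+ m.
  apply/ler_addgt0Pr => eps eps0.
  have [n0 h0] := (cvg_seqP _ _).1 (dC A n) eps eps0.
  have h1 := h0 (maxn n0 m) (leq_maxl _ _).
  have h2 : `|psum e A (d (maxn n0 m)) n - psum e A (d m) n| <=
      2 * (M * `|x|) * 2^-1 ^+ m.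
    apply: (geometric_dist (s := fun m => psum e A (d m) n)) => [k|].
      by rewrite dS; exact: cP.
    exact: leq_maxr.
  rewrite -(subrK (psum e A (d (maxn n0 m)) n) (psum e A C n)) -addrA.
  by rewrite (le_trans (ler_normD _ _))// [leRHS]addrC lerD.
exists C; split=> [|A n]; last first.
  have := d_near A n 0%N; rewrite expr0 mulr1 mulrA.
  by rewrite /d psum_sum big_ord0 subr0.
apply/cvg_seqP => eps eps0.
(* Three errors: the residual [r m], the replacement of [C] by [d m], uniform in [n], and the
   convergence of the expansion [d m] once [m] is fixed. *)
have e3 : 0 < eps / 3 by rewrite divr_gt0.
have [m1 hm1] := geom_small (2 * (M * `|x|)) e3.
have [m2 hm2] := geom_small `|x| e3.
pose m := maxn m1 m2.
have ad m' : expands_to e (d m') (\sum_(k < m') a (r k)).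
  rewrite /d; elim: m' => [|m' IH].
    have [c' [c'0 _]] := expansion_bounded0.
    rewrite big_ord0; have := expandsZ (l := 0) c'0; rewrite scale0r.
    by congr expands_to; apply/funext => i; rewrite mul0r big_ord0.
  rewrite big_ord_recr /=; have := expandsD IH (hcf _ (rs m')).1.
  by congr expands_to; apply/funext => i; rewrite big_ord_recr.
have [n0 hn0] := (cvg_seqP _ _).1 (ad m) _ e3.
exists n0 => n /hn0; rewrite -!/(psum e xpredT _ n) -sum_a => h1.
have h2 := le_trans (r_le m) (hm2 m (leq_maxr _ _)).
have h3 := le_trans (d_near xpredT n m) (hm1 m (leq_maxl _ _)).
have -> : x - psum e xpredT C n = (x - r m - psum e xpredT (d m) n) +
    (r m - (psum e xpredT C n - psum e xpredT (d m) n)).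
  by rewrite opprB addrACA subrK addKr.
rewrite (le_trans (ler_normD _ _))//.
have := ler_normB (r m) (psum e xpredT C n - psum e xpredT (d m) n); lra.
Qed.

End OpenMapping.

Section Unconditional.
Context {R : realType}.

Lemma norm_segment_le (V : normedModType R) (v w : V) (l : R) : `|l| <= 1 ->
  `|v + l *: w| <= `|v + w| \/ `|v + l *: w| <= `|v - w|.
Proof.
rewrite ler_norml => /andP[l1 l2].
have -> : v + l *: w = ((1 + l) / 2) *: (v + w) + ((1 - l) / 2) *: (v - w).
  rewrite !scalerDr addrACA -scalerDl scalerN -scalerBl -[v in LHS]scale1r.
  by congr (_ *: _ + _ *: _); field.
have h := ler_normD (((1 + l) / 2) *: (v + w)) (((1 - l) / 2) *: (v - w)).
have h1 : `|(1 + l) / 2| = (1 + l) / 2 by apply: ger0_norm; lra.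
have h2 : `|(1 - l) / 2| = (1 - l) / 2 by apply: ger0_norm; lra.
rewrite (normrZ ((1 + l) / 2)) (normrZ ((1 - l) / 2)) h1 h2 in h.
have [vw|/ltW vw] := lerP `|v - w| `|v + w|; [left|right]; nra.
Qed.

(** A norm is convex, hence largest at a vertex of a cube. One coordinate at a time is pushed to a
    sign, and [v] absorbs those already fixed. *)
Lemma norm_cube_le_sign (V : normedModType R) (w : nat -> V) (l : nat -> R) n :
  (forall i, `|l i| <= 1) ->
  forall v, exists A : pred nat, `|v + \sum_(i < n) l i *: w i| <=
    `|v + \sum_(i < n) (if A i then w i else - w i)|.
Proof.
move=> l1; elim: n => [|n IH] v; first by exists xpredT; rewrite !big_ord0.
have [s hs] : exists s : bool, `|v + \sum_(i < n.+1) l i *: w i| <=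
    `|v + (if s then w n else - w n) + \sum_(i < n) l i *: w i|.
  rewrite big_ord_recr /= addrA.
  have [h|h] := norm_segment_le (v + \sum_(i < n) l i *: w i) (w n) (l1 n).
    by exists true; rewrite /= [v + w n + _]addrAC.
  by exists false; rewrite /= [v - w n + _]addrAC.
have [A hA] := IH (v + if s then w n else - w n).
exists (fun i => if i == n then s else A i).
rewrite (le_trans hs)// (le_trans hA)// big_ord_recr /= eqxx -addrA [X in v + X]addrC.
rewrite le_eqVlt; apply/orP; left; apply/eqP; congr (`|v + (_ + _)|).
by apply: eq_bigr => i _; rewrite ltn_eqF.
Qed.

Context {X : completeNormedModType R} {e : nat -> X}.

(** Rearrangements bound the projections of each vector, [expansion_constant] makes the bound
    uniform, and multipliers reduce to signs. A signed sum is the difference of the projections onto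
    a set and its complement, whence [2 * K]. *)
Lemma unconditional_constant : normalized e -> unconditional_basic e ->
  exists2 K, 0 <= K & forall x c, expands_to e c x ->
    forall (l : nat -> R) n, (forall i, `|l i| <= 1) ->
      `|psum e xpredT (fun i => l i * c i) n| <= K * `|x|.
Proof.
move=> e1 [eB eU].
have [|K hK] := expansion_constant e1 eB.
  move=> x sx; have [c [cx _]] := eB x sx.
  have [M hM] := rearrangement_bounded (F := fun i => c i *: e i) (eU x c sx cx).
  by exists M, c.
(* Nonnegativity is read off from the empty partial sum of [e 0], a vector of norm 1. *)
have K0 : 0 <= K.
  have := hK (e 0%N) (fun i => if (i < 1)%N then 1 else 0) _ xpredT 0%N.
  rewrite /psum big_ord0 normr0 e1 mulr1; apply.
  have <- : psum e xpredT (fun=> 1) 1 = e 0%N.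
    by rewrite /psum big_ord_recr big_ord0 /= add0r scale1r.
  exact: expands_psum.
exists (2 * K) => [|x c cx l n l1]; first by rewrite mulr_ge0.
have [A] := norm_cube_le_sign (fun i => c i *: e i) n l1 0.
rewrite !add0r; under eq_bigr do rewrite scalerA.
move=> /le_trans; apply.
have -> : \sum_(i < n) (if A i then c i *: e i else - (c i *: e i)) =
    psum e A c n - psum e (predC A) c n.
  rewrite psum_if [psum e (predC A) _ _]psum_if -sumrB.
  by apply: eq_bigr => i _ /=; case: (A i); rewrite scale0r ?subr0 ?sub0r.
have := ler_normB (psum e A c n) (psum e (predC A) c n).
have := hK x c cx A n; have := hK x c cx (predC A) n; lra.
Qed.

End Unconditional.

(** * Block vectors with uniform constants, and subsequences *)

Section BlockBases.
Context {R : realType} {X : normedModType R} {e : nat -> X} {K : R}.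
Hypothesis e1 : normalized e.
Hypothesis K0 : 0 <= K.
Hypothesis mult : forall (c l : nat -> R) n, (forall i, `|l i| <= 1) ->
  `|psum e xpredT (fun i => l i * c i) n| <= K * `|psum e xpredT c n|.

Lemma psum_subset_le (A : pred nat) c n : `|psum e A c n| <= K * `|psum e xpredT c n|.
Proof.
have h := @mult c (fun i => (A i)%:R) n; rewrite psum_if.
apply: le_trans (h _) => [|i]; last by case: (A i); rewrite ?normr1 ?normr0.
rewrite le_eqVlt; apply/orP; left; apply/eqP; congr (`|_|).
by apply: eq_bigr => i _; case: (A i); rewrite ?mul1r ?mul0r.
Qed.

Lemma coef_le c n i : (i < n)%N -> `|c i| <= K * `|psum e xpredT c n|.
Proof.
move=> i_n; have := psum_subset_le (pred1 i) c n.
rewrite {1}/psum (big_pred1 (Ordinal i_n)) => [|j]; last by rewrite /= -val_eqE.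
by rewrite normrZ e1 mulr1.
Qed.

Lemma psum_le_sum (V : normedModType R) (v : nat -> V) c n m : (m <= n)%N ->
  (forall i, `|v i| <= 1) ->
  `|psum v xpredT c m| <= m%:R * K * `|psum e xpredT c n|.
Proof.
move=> mn v1; rewrite (le_trans (ler_norm_sum _ _ _))//.
rewrite -mulrA mulr_natl -[X in _ *+ X]card_ord -sumr_const ler_sum// => i _.
rewrite normrZ (@le_trans _ _ `|c i|)//; first by rewrite ler_piMr.
by apply: coef_le; rewrite (leq_trans _ mn).
Qed.

Definition in_block (q : nat -> nat) (n : nat) (v : X) :=
  exists d : nat -> R, v = \sum_(q n <= j < q n.+1) d j *: e j.

Hypothesis dom : dominates_normalized_block_bases e.

(** A subsequence is itself a block basis: block [k] ends at [phi k], with coefficient 1 there and 0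
    before it. *)
Lemma subseq_dominated (phi : nat -> nat) : (forall k, (phi k < phi k.+1)%N) ->
  dominates e (e \o phi).
Proof.
move=> phiS.
pose q k := if k is k'.+1 then (phi k').+1 else 0%N.
have qS k : (q k < q k.+1)%N by case: k => //= k; rewrite ltnS.
have [blk [blkP blkE]] := block_index erefl qS.
apply: dom; last by move=> i; exact: e1.
exists q, (fun j => (j == phi (blk j))%:R); split=> //; split=> k; last first.
  by rewrite -normr_eq0 e1 oner_neq0.
have pk : (q k <= phi k)%N by case: k => //= k; exact: phiS.
rewrite [RHS]big_nat_recr//= big_nat big1 ?add0r => [|j /andP[j1 j2]].
  rewrite (blkE (phi k) k) ?eqxx ?scale1r//.
  by rewrite pk /= ltnSn.
rewrite (blkE j k) ?(ltn_eqF j2) ?scale0r//.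
by rewrite j1 /= ltnS ltnW.
Qed.

Context {q : nat -> nat}.
Hypothesis q0 : q 0%N = 0%N.
Hypothesis qS : forall k, (q k < q k.+1)%N.

(** Normalizing turns [v] into a normalized block basis, zero vectors being replaced by [e (q n)].
    The norms, at most 1, return as multipliers and cost the factor [K]. *)
Lemma block_ball_dominated (v : nat -> X) :
  (forall n, in_block q n (v n) /\ `|v n| <= 1) -> dominates e v.
Proof.
move=> vP.
have /choice[d hd] : forall n, exists d : nat -> R,
  v n = \sum_(q n <= j < q n.+1) d j *: e j by move=> n; exact: (vP n).1.
have [blk [blkP blkE]] := block_index q0 qS.
pose y n := if v n == 0 then e (q n) else `|v n|^-1 *: v n.
have y1 : normalized y.
  move=> n; rewrite /y; case: eqVneq => [_|vn]; first exact: e1.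
  by rewrite normrZ ger0_norm ?invr_ge0// mulVf// normr_eq0.
have [|//|C hC] := @dom y.
  exists q, (fun j => let n := blk j in
    if v n == 0 then (j == q n)%:R else `|v n|^-1 * d n j); split=> //; split=> n.
    rewrite big_nat (eq_bigr (fun j => (if v n == 0 then (j == q n)%:R
      else `|v n|^-1 * d n j) *: e j)) => [|j /blkE->//].
    rewrite -big_nat /y; case: eqVneq => [_|vn]; last first.
      by rewrite {2}hd scaler_sumr; apply: eq_bigr => j _; rewrite scalerA.
    rewrite (big_ltn (qS n)) eqxx scale1r big_nat big1 ?addr0// => j /andP[jn _].
    by rewrite gtn_eqF// scale0r.
  by rewrite -normr_eq0 y1 oner_neq0.
exists (`|C| * K) => N a.
have -> : \sum_(i < N) a i *: v i = \sum_(i < N) (`|v i| * a i) *: y i.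
  apply: eq_bigr => i _; rewrite /y; case: eqVneq => [->|vn].
    by rewrite normr0 mul0r scale0r scaler0.
  by rewrite scalerA mulrC mulrA mulVf ?mul1r// normr_eq0.
rewrite (le_trans (hC N (fun i => `|v i| * a i)))//.
rewrite -mulrA (@le_trans _ _ (`|C| * `|\sum_(i < N) (`|v i| * a i) *: e i|))//.
  by rewrite ler_wpM2r// ler_norm.
rewrite ler_wpM2l//; apply: (@mult a (fun i => `|v i|) N) => i; rewrite normr_id; exact: (vP i).2.
Qed.

(* Gluing the tails of families with worse and worse constants would give a single
   family in the block balls that [e] does not dominate. *)
Lemma block_ball_uniform : exists2 C, 0 <= C & forall v : nat -> X,
  (forall n, in_block q n (v n) /\ `|v n| <= 1) ->
  forall N (b : nat -> R), `|psum v xpredT b N| <= C * `|psum e xpredT b N|.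
Proof.
apply: contrapT => H.
have /choice[f hf] : forall Mk : nat * nat, exists vNb : (nat -> X) * (nat * (nat -> R)),
    [/\ forall n, in_block q n (vNb.1 n) /\ `|vNb.1 n| <= 1, (Mk.1 < vNb.2.1)%N &
    Mk.2%:R * `|psum e (leq Mk.1) vNb.2.2 vNb.2.1| < `|psum vNb.1 (leq Mk.1) vNb.2.2 vNb.2.1| ].
  move=> [M k]; apply: contrapT => /forallNP H'; apply: H.
  (* If no family violated the ratio [k] from index [M] on, this constant would serve all families:
     the first [M] terms are controlled through their coefficients, the rest through the ratio. *)
  exists (k%:R * K + M%:R * K) => [|v vP N b]; first by rewrite addr_ge0 ?mulr_ge0.
  have [NM|MN] := leqP N M.
    apply: le_trans (psum_le_sum b (leqnn N) (fun i => (vP i).2)) _.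
    rewrite ler_wpM2r// -mulrDl ler_wpM2r// -natrD ler_nat; lia.
  have /not_and3P[//|//|/negP] := H' (v, (N, b)); rewrite -leNgt /= => h.
  have -> : psum v xpredT b N = psum v xpredT b M + psum v (leq M) b N.
    rewrite -(psum_trunc v _ b (ltnW MN)) [psum v (leq M) b N]psum_if -psumD.
    by apply: eq_bigr => i _; case: ltnP; rewrite ?addr0 ?add0r.
  have h1 := psum_le_sum b (ltnW MN) (fun i => (vP i).2).
  have h2 : k%:R * `|psum e (leq M) b N| <= k%:R * K * `|psum e xpredT b N|.
    by rewrite -mulrA ler_wpM2l//; exact: psum_subset_le.
  have := ler_normD (psum v xpredT b M) (psum v (leq M) b N); lra.
pose m k := nat_rect (fun=> nat) 0%N (fun k M => (f (M, k)).2.1) k.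
have mS k : (m k < m k.+1)%N by have [] := hf (m k, k).
have [blk [blkP blkE]] := block_index (q := m) erefl mS.
(* The indices from [m k] to [m k.+1] carry the family that violates the ratio [k], and coefficients
   supported there see no other family. *)
pose v n := (f (m (blk n), blk n)).1 n.
have [|C hC] := @block_ball_dominated v.
  by move=> n; have [+ _ _] := hf (m (blk n), blk n); apply.
have [k hk] : exists k : nat, C <= k%:R.
  exists (Num.truncn C).+1; apply: ltW; exact: truncnS_gt.
have [_ _] := hf (m k, k); rewrite ltNge => /negP; apply; rewrite /=.
have := hC (m k.+1) (fun i => if (m k <= i)%N then (f (m k, k)).2.2 i else 0).
have psumE (w : nat -> X) : \sum_(i < m k.+1)
    (if (m k <= i)%N then (f (m k, k)).2.2 i else 0) *: w i =
    psum w (leq (m k)) (f (m k, k)).2.2 (m k.+1) by rewrite psum_if.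
rewrite !psumE => h.
have <- : psum v (leq (m k)) (f (m k, k)).2.2 (m k.+1) =
    psum (f (m k, k)).1 (leq (m k)) (f (m k, k)).2.2 (m k.+1).
  apply: eq_bigr => i mi; rewrite /v (blkE i k)//.
  by rewrite mi /=; exact: ltn_ord.
by apply: le_trans h _; rewrite ler_wpM2r.
Qed.

End BlockBases.

Section Subsequences.
Context {R : realType}.

(** [q] and [blk] depend on [p] alone, so one choice of coefficients rewrites sums in two different
    spaces simultaneously. *)
Lemma subseq_psum (p : nat -> nat) : (forall k, (p k < p k.+1)%N) ->
  exists q blk : nat -> nat, forall (V : normedModType R) (v : nat -> V) (c : nat -> R) n,
    psum (v \o p) xpredT c n =
    psum v xpredT (fun j => c (blk j) * (j == p (blk j))%:R) (q n).
Proof.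
move=> pS; pose q k := if k is k'.+1 then (p k').+1 else 0%N.
have qS k : (q k < q k.+1)%N by case: k => //= k; rewrite ltnS.
have [blk [blkP blkE]] := block_index erefl qS.
exists q, blk => V v c; elim=> [|n IH]; first by rewrite /psum !big_ord0.
have pn : (q n <= p n)%N by case: (n) => //= k; exact: pS.
rewrite psum_nat big_nat_recr//= -psum_nat IH !psum_nat.
rewrite [RHS](big_cat_nat _ (ltnW (qS n)))//=; congr (_ + _).
rewrite big_nat_recr//= big_nat big1 ?add0r => [|j /andP[j1 j2]].
  by rewrite (blkE (p n) n) ?eqxx ?mulr1//= pn /=.
rewrite (blkE j n) ?(ltn_eqF j2) ?mulr0 ?scale0r//.
by rewrite j1 /= ltnS ltnW.
Qed.

Lemma subseq_multiplier {V : normedModType R} {e : nat -> V} {K : R} (p : nat -> nat) :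
  (forall (c l : nat -> R) n, (forall i, `|l i| <= 1) ->
    `|psum e xpredT (fun i => l i * c i) n| <= K * `|psum e xpredT c n|) ->
  (forall k, (p k < p k.+1)%N) ->
  forall (c l : nat -> R) n, (forall i, `|l i| <= 1) ->
    `|psum (e \o p) xpredT (fun i => l i * c i) n| <=
      K * `|psum (e \o p) xpredT c n|.
Proof.
move=> mult /subseq_psum[q [blk E]] c l n l1; rewrite !E.
have := @mult (fun j => c (blk j) * (j == p (blk j))%:R) (l \o blk) (q n) (fun j => l1 _).
apply: le_trans; rewrite le_eqVlt; apply/orP; left; apply/eqP; congr (`|_|).
by apply: eq_bigr => j _; rewrite mulrA.
Qed.

(** The estimate for [z], applied to coefficients vanishing off the range of [phi], compares with
    [e \o phi], which [e] dominates. *)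
Lemma dominates_subseq {V W : normedModType R} {e : nat -> V} {z : nat -> W}
    (phi : nat -> nat) :
  normalized e -> dominates_normalized_block_bases e ->
  (forall k, (phi k < phi k.+1)%N) ->
  dominates e z -> dominates e (z \o phi).
Proof.
move=> e1 dom phiS [C hC]; have [D hD] := subseq_dominated e1 dom phiS.
have [q [blk E]] := subseq_psum phiS.
exists (`|C| * D) => N a.
rewrite -[X in `|X| <= _]/(psum (z \o phi) xpredT a N) (E W z) (le_trans (hC _ _))//.
have := hD N a; rewrite -[X in `|X| <= _]/(psum (e \o phi) xpredT a N) (E V e) -mulrA => h.
apply: le_trans (ler_wpM2l (normr_ge0 C) h).
by rewrite ler_wpM2r// ler_norm.
Qed.

End Subsequences.

(** * The norm of [J] and the upper estimate for blocks of zero sum *)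

Section JamesNorm.
Context {R : realType} {X : normedModType R} {e : nat -> X}.
Context {J : normedModType R} {u : nat -> J}.

(** The competing vectors in the supremum that defines the norm of [J]. *)
Definition interval_psum (p : nat -> nat) (k : nat) (a : nat -> R) : X :=
  psum (e \o p) xpredT (fun i => \sum_(p i <= j < p i.+1) a j) k.

Hypothesis uJ : is_J_space e u.

Lemma interval_psum_le (p : nat -> nat) k (a : nat -> R) N :
  p 0%N = 0%N -> (forall i, (p i < p i.+1)%N) -> (forall j, (N <= j)%N -> a j = 0) ->
  `|interval_psum p k a| <= `|psum u xpredT a N|.
Proof.
move=> p0 pS a0; have [->|k0] := posnP k.
  by rewrite /interval_psum /psum big_ord0 normr0.
by have [+ _] := uJ.2 N a a0; apply; exists k, p.
Qed.

Lemma Jnorm_le (a : nat -> R) N (M : R) : (forall j, (N <= j)%N -> a j = 0) ->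
  (forall p k, p 0%N = 0%N -> (forall i, (p i < p i.+1)%N) ->
    `|interval_psum p k a| <= M) ->
  `|psum u xpredT a N| <= M.
Proof.
move=> a0 H; have [_] := uJ.2 N a a0; apply => _ [k [p [k0 [p0 [pS ->]]]]].
(* A partition says nothing beyond [k]; unit steps continue it, so that later arguments may assume
   [p] increasing everywhere. *)
pose p' i := if (i <= k)%N then p i else (p k + (i - k))%N.
have p'E i : (i <= k)%N -> p' i = p i by rewrite /p' => ->.
have p'S i : (p' i < p' i.+1)%N.
  rewrite /p'; have [ik|ki|->] := ltngtP i k.
  - exact: pS.
  - by rewrite ltn_add2l; lia.
  - by rewrite subSnn addn1.
apply: le_trans (H p' k _ p'S); last by rewrite p'E.
rewrite le_eqVlt; apply/orP; left; apply/eqP; congr (`|_|).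
by apply: eq_bigr => i _ /=; rewrite !p'E// ltnW.
Qed.

Lemma interval_psum_sum (p : nat -> nat) k N (b : nat -> R) (z : nat -> nat -> R) :
  interval_psum p k (fun j => \sum_(n < N) b n * z n j) =
  \sum_(n < N) b n *: interval_psum p k (z n).
Proof.
under [RHS]eq_bigr do rewrite -psumZ.
rewrite -[RHS](psum_sum (e \o p) xpredT
  (fun n i => b n * \sum_(p i <= j < p i.+1) z n j)).
apply: eq_bigr => i _; congr (_ *: _); rewrite exchange_big /=.
by apply: eq_bigr => n _; rewrite mulr_sumr.
Qed.

Lemma sum_le_Jnorm (a : nat -> R) N : normalized e -> (forall j, (N <= j)%N -> a j = 0) ->
  `|\sum_(j < N) a j| <= `|psum u xpredT a N|.
Proof.
move=> e1 a0; have [->|N0] := posnP N; first by rewrite big_ord0 normr0.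
(* One interval covers the whole support; the multiples of [N] merely continue it increasingly. *)
have := @interval_psum_le (fun i => i * N)%N 1 a N.
rewrite /interval_psum /psum big_ord_recr big_ord0 /= add0r mul0n mul1n.
rewrite normrZ e1 mulr1 big_mkord; apply => // i.
by rewrite ltn_pmul2r.
Qed.

Lemma psum_le_Jnorm (a : nat -> R) N n : (forall j, (N <= j)%N -> a j = 0) ->
  `|psum e xpredT a n| <= `|psum u xpredT a N|.
Proof.
move=> a0; have := @interval_psum_le id n a N erefl (fun i => leqnn _) a0.
apply: le_trans; rewrite le_eqVlt; apply/orP; left; apply/eqP; congr (`|_|).
by apply: eq_bigr => i _; rewrite big_nat1.
Qed.

End JamesNorm.

Section UpperEstimate.
Context {R : realType} {X : normedModType R} {e : nat -> X} {K : R}.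
Context {J : normedModType R} {u : nat -> J}.
Hypothesis e1 : normalized e.
Hypothesis K0 : 0 <= K.
Hypothesis mult : forall (c l : nat -> R) n, (forall i, `|l i| <= 1) ->
  `|psum e xpredT (fun i => l i * c i) n| <= K * `|psum e xpredT c n|.
Hypothesis dom : dominates_normalized_block_bases e.
Hypothesis rdom : right_dominant e.
Hypothesis uJ : is_J_space e u.

Lemma in_block_sum (q : nat -> nat) n (I : Type) (r : seq I) (P : pred I)
    (s : I -> R) (m : I -> nat) :
  (forall i, P i -> (q n <= m i < q n.+1)%N) ->
  in_block (e := e) q n (\sum_(i <- r | P i) s i *: e (m i)).
Proof.
move=> Pm; apply: (big_ind (in_block (e := e) q n)).
- by exists (fun=> 0); rewrite big1// => j _; rewrite scale0r.
- move=> _ _ [a ->] [b ->]; exists (fun j => a j + b j).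
  by rewrite -big_split; apply: eq_bigr => j _; rewrite scalerDl.
- move=> i /Pm/andP[qm mq]; exists (fun j => if j == m i then s i else 0).
  rewrite (big_cat_nat _ (ltnW mq) (n := m i))//= big_nat big1 => [|j /andP[_ jm]].
    rewrite add0r big_ltn// eqxx big_nat big1 ?addr0// => j /andP[jm _].
    by rewrite gtn_eqF ?scale0r.
  by rewrite ltn_eqF ?scale0r.
Qed.

Section Blocks.
Context {q : nat -> nat} {z : nat -> nat -> R}.
Hypothesis q0 : q 0%N = 0%N.
Hypothesis qS : forall k, (q k < q k.+1)%N.
Hypothesis zsupp : forall n j, ~~ (q n <= j < q n.+1)%N -> z n j = 0.
Hypothesis zsum : forall n, \sum_(q n <= j < q n.+1) z n j = 0.

Let starts_in (p : nat -> nat) n i := (q n <= p i < q n.+1)%N.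
(** The strict inequality at [q n] and the weak one at [q n.+1] put the last index [(p i.+1).-1] of
    the interval in block [n]. *)
Let straddles (p : nat -> nat) n i := (p i < q n < p i.+1)%N && (p i.+1 <= q n.+1)%N.

(** An interval of neither kind misses block [n] or covers it entirely, and then [zsum] applies. *)
Lemma interval_sum_eq0 (p : nat -> nat) n i : (p i < p i.+1)%N ->
  ~~ starts_in p n i -> ~~ straddles p n i -> \sum_(p i <= j < p i.+1) z n j = 0.
Proof.
move=> pS; rewrite /starts_in /straddles => h1 h2.
have [h|h] := boolP ((q n.+1 <= p i) || (p i.+1 <= q n))%N.
  by rewrite big_nat big1// => j hj; apply: zsupp; lia.
have a1 : (p i <= q n)%N by lia.
have a2 : (q n.+1 <= p i.+1)%N by lia.
have a3 := ltnW (qS n).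
rewrite (big_cat_nat a1)/=; last by lia.
rewrite (big_cat_nat a3 a2) /= zsum add0r.
by rewrite ![\sum_(_ <= j < _) _]big_nat !big1 ?addr0// => j hj; apply: zsupp; lia.
Qed.

Lemma interval_psum_split (p : nat -> nat) n k : (forall i, (p i < p i.+1)%N) ->
  interval_psum (e := e) p k (z n) =
  psum (e \o p) (starts_in p n) (fun i => \sum_(p i <= j < p i.+1) z n j) k +
  psum (e \o p) (straddles p n) (fun i => \sum_(p i <= j < p i.+1) z n j) k.
Proof.
move=> pS; rewrite psum_if [psum _ (straddles p n) _ _]psum_if -psumD.
apply: eq_bigr => i _; congr (_ *: _).
have := @interval_sum_eq0 p n i (pS i).
case: ifP => h1; case: ifP => h2; rewrite ?addr0 ?add0r//; last exact.
by move: h1 h2; rewrite /starts_in /straddles; lia.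
Qed.

(** At most one interval crosses [q n], so both sides are the norm of one multiple of a normalized
    vector. Bounds at the left ends thus pass to the last indices. *)
Lemma straddling_norm (p : nat -> nat) n k (s : nat -> R) :
  (forall i, (p i < p i.+1)%N) ->
  `|psum (fun i => e (p i.+1).-1) (straddles p n) s k| =
  `|psum (e \o p) (straddles p n) s k|.
Proof.
move=> pS; have [[i ik hi]|no] := EM (exists2 i, (i < k)%N & straddles p n i).
  have uniq_i (j : 'I_k) : straddles p n j = (j == Ordinal ik).
    rewrite -val_eqE /=; apply/idP/eqP => [hj|->//].
    have [ij|ij|//] := ltngtP j i.
    - have := increasing_leq pS ij; move: hi hj; rewrite /straddles; lia.
    - have := increasing_leq pS ij; move: hi hj; rewrite /straddles; lia.
  by rewrite /psum !(big_pred1 (Ordinal ik))// !normrZ /= !e1.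
by rewrite /psum !big1// => i hi; case: no; exists i.
Qed.

(** Projecting the interval sums of [z n] along [e \o p] bounds both pieces by [K * M], and
    [block_ball_uniform] makes the resulting estimate independent of the partition. *)
Lemma block_upper_estimate (M : R) :
  (forall n, `|psum u xpredT (z n) (q n.+1)| <= M) ->
  dominates e (fun n => psum u xpredT (z n) (q n.+1)).
Proof.
move=> zM.
have M0 : 0 <= M by exact: le_trans (normr_ge0 _) (zM 0%N).
have [C C0 hC] := block_ball_uniform e1 K0 mult dom q0 qS.
have [_ [D hD]] := rdom.
(* Adding 1 keeps the scaling factor invertible when [K * M] is 0. *)
pose B := K * M + 1.
have B0 : 0 < B by rewrite ltr_wpDl// mulr_ge0.
have hCB (v : nat -> X) N (b : nat -> R) :
    (forall n, in_block (e := e) q n (v n) /\ `|v n| <= K * M) ->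
    `|\sum_(n < N) b n *: v n| <= C * B * `|psum e xpredT b N|.
  move=> vP; have nB w : `|B^-1 *: w| = `|w| / B :> R.
    by rewrite normrZ ger0_norm ?invr_ge0 ?ltW// mulrC.
  have /hC/(_ N b) : forall n, in_block (e := e) q n (B^-1 *: v n) /\ `|B^-1 *: v n| <= 1.
    move=> n; have [[d vE] vM] := vP n; split.
      exists (fun j => B^-1 * d j); rewrite vE scaler_sumr.
      by apply: eq_bigr => j _; rewrite scalerA.
    by rewrite nB ler_pdivrMr// mul1r (le_trans vM)// lerDl.
  have -> : psum (fun n => B^-1 *: v n) xpredT b N = B^-1 *: \sum_(n < N) b n *: v n.
    by rewrite scaler_sumr; apply: eq_bigr => i _; rewrite !scalerA mulrC.
  by rewrite nB ler_pdivrMr// mulrAC.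
exists (C * B + `|D| * (C * B)) => N b.
pose a j := \sum_(n < N) b n * z n j.
have qle n j : (n < N)%N -> (q N <= j)%N -> (q n.+1 <= j)%N.
  by move=> nN; apply: leq_trans; exact: increasing_leq.
have -> : \sum_(n < N) b n *: psum u xpredT (z n) (q n.+1) = psum u xpredT a (q N).
  rewrite (psum_sum u xpredT (fun n j => b n * z n j)).
  apply: eq_bigr => n _; rewrite psumZ; congr (_ *: _).
  rewrite (@psum_widen _ _ u (z n) (q n.+1) (q N))//; first exact: increasing_leq.
  by move=> j qj; apply: zsupp; lia.
apply: (Jnorm_le uJ) => [j qj|p k p0 pS].
  rewrite /a big1// => n _; rewrite zsupp ?mulr0//; have := qle n j (ltn_ord n) qj; lia.
have Psub := psum_subset_le (subseq_multiplier mult pS).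
pose s n i := \sum_(p i <= j < p i.+1) z n j.
have IM n : `|psum (e \o p) xpredT (s n) k| <= M.
  apply: le_trans (zM n); apply: (interval_psum_le uJ) => // j qj.
  by apply: zsupp; lia.
have PM A n : `|psum (e \o p) A (s n) k| <= K * M.
  by rewrite (le_trans (Psub _ _ _))// ler_wpM2l.
rewrite interval_psum_sum; under eq_bigr do rewrite interval_psum_split// scalerDr.
rewrite big_split /= mulrDl (le_trans (ler_normD _ _))// lerD//.
  apply: (hCB (fun n => psum (e \o p) (starts_in p n) (s n) k)) => n.
  split; last exact: PM.
  exact: in_block_sum.
(* Right dominance compares sums over intervals, the block estimate sums over blocks. Collecting the
   straddling coefficients by interval gives access to both. *)
pose c i := \sum_(n < N) b n * (if straddles p n i then s n i else 0).
have E (w : nat -> X) : \sum_(n < N) b n *: psum w (straddles p n) (s n) k =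
    psum w xpredT c k.
  rewrite (psum_sum w xpredT (fun n i => b n * (if straddles p n i then s n i else 0))).
  by apply: eq_bigr => n _; rewrite psumZ psum_if.
rewrite E (@le_trans _ _ (`|D| * `|psum (fun i => e (p i.+1).-1) xpredT c k|))//.
  have := hD p (fun i => (p i.+1).-1) _ k c => h.
  apply: le_trans (h _) _; last by rewrite ler_wpM2r// ler_norm.
  by move=> i; have := pS i; have := pS i.+1; lia.
rewrite -mulrA ler_wpM2l// -E.
apply: (hCB (fun n => psum (fun i => e (p i.+1).-1) (straddles p n) (s n) k)) => n.
split; last first.
  by rewrite straddling_norm//; exact: PM.
apply: in_block_sum => i; rewrite /straddles; lia.
Qed.

End Blocks.

(** Each coefficient is at most [K] times the norm of the [e]-sum, and the perturbations add up to
    at most 2. *)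
Lemma perturbed_dominated (z w : nat -> J) :
  (forall n, `|z n - w n| <= 2^-1 ^+ n) -> dominates e w -> dominates e z.
Proof.
move=> zw [C hC]; exists (C + 2 * K) => N b.
have -> : \sum_(n < N) b n *: z n = \sum_(n < N) b n *: w n +
    \sum_(n < N) b n *: (z n - w n).
  by rewrite -big_split; apply: eq_bigr => n _; rewrite /= -scalerDr addrC subrK.
rewrite mulrDl (le_trans (ler_normD _ _))// lerD// (le_trans (ler_norm_sum _ _ _))//.
set P := `|\sum_(i < N) b i *: e i|.
have geo m : \sum_(n < m) 2^-1 ^+ n <= 2 - 2 * 2^-1 ^+ m :> R.
  elim: m => [|m IH]; first by rewrite big_ord0 expr0; lra.
  rewrite big_ord_recr /= exprS; lra.
rewrite (@le_trans _ _ (\sum_(n < N) K * P * 2^-1 ^+ n))//.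
  apply: ler_sum => n _; rewrite normrZ ler_pM//.
  exact: (coef_le e1 mult).
have P0 : 0 <= K * P by apply: mulr_ge0 => //; exact: normr_ge0.
rewrite -mulr_sumr (le_trans (ler_wpM2l P0 (geo N)))//.
have : 0 <= K * P * 2^-1 ^+ N by rewrite mulr_ge0.
lra.
Qed.

End UpperEstimate.

(** * Extraction of sequences close to blocks of zero sum *)

Section TailNull.
Context {R : realType} {X : normedModType R} {e : nat -> X} {K : R}.
Context {J : normedModType R} {u : nat -> J}.
Hypothesis e1 : normalized e.
Hypothesis K0 : 0 <= K.
Hypothesis mult : forall (c l : nat -> R) n, (forall i, `|l i| <= 1) ->
  `|psum e xpredT (fun i => l i * c i) n| <= K * `|psum e xpredT c n|.
Hypothesis dom : dominates_normalized_block_bases e.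
Hypothesis rdom : right_dominant e.
Hypothesis uJ : is_J_space e u.

Definition tail_zero_sum (q : nat) (w : J) :=
  exists (a : nat -> R) (N : nat), [/\ forall j, (j < q)%N || (N <= j)%N -> a j = 0,
    \sum_(j < N) a j = 0 & w = psum u xpredT a N].

(** A substitute for weak nullity that directly supplies the supports and zero sums required by the
    upper estimate. *)
Definition tail_null (z : nat -> J) := forall q (eps : R), 0 < eps ->
  exists k0 : nat, forall k, (k0 <= k)%N ->
    exists w, tail_zero_sum q w /\ `|z k - w| <= eps.

Definition tail_cauchy (x : nat -> J) := forall q (eps : R), 0 < eps ->
  exists k0 : nat, forall m n, (k0 <= m)%N -> (k0 <= n)%N ->
    exists w, tail_zero_sum q w /\ `|x m - x n - w| <= eps.

Lemma tail_cauchy_null (x : nat -> J) (m n : nat -> nat) : tail_cauchy x ->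
  (forall k, (k <= m k)%N) -> (forall k, (k <= n k)%N) ->
  tail_null (fun k => x (m k) - x (n k)).
Proof.
move=> xC km kn q eps /(xC q)[k0 h]; exists k0 => k kk.
by apply: h; exact: leq_trans kk _.
Qed.

(** Gliding hump: each chosen term is within [2^-n] of a vector of zero sum supported beyond the
    previous one, and such an error does not spoil the upper estimate. *)
Lemma tail_null_dominated_subseq (z : nat -> J) (B : R) : tail_null z ->
  (forall k, `|z k| <= B) ->
  exists psi : nat -> nat, (forall k, (psi k < psi k.+1)%N) /\ dominates e (z \o psi).
Proof.
move=> z0 zB.
have /choice[f hf] : forall qkn : (nat * nat) * nat,
    exists kaN : nat * ((nat -> R) * nat),
    [/\ (qkn.1.2 <= kaN.1)%N,
      forall j, (j < qkn.1.1)%N || (kaN.2.2 <= j)%N -> kaN.2.1 j = 0,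
      \sum_(j < kaN.2.2) kaN.2.1 j = 0 &
      `|z kaN.1 - psum u xpredT kaN.2.1 kaN.2.2| <= 2^-1 ^+ qkn.2].
  move=> [[q k] n] /=.
  have [|k0 h] := z0 q (2^-1 ^+ n); first by rewrite exprn_gt0// invr_gt0.
  have [_ [[a [N [a0 as0 ->]]] hw]] := h (maxn k k0) (leq_maxr _ _).
  by exists (maxn k k0, (a, N)); split=> //=; exact: leq_maxl.
(* The state holds the left end of the next block and the least index allowed for the next term. A
   block is nonempty and reaches past the support just found. *)
pose st n := nat_rect (fun=> (nat * nat)%type) (0%N, 0%N) (fun n qk =>
  (maxn qk.1.+1 (f (qk, n)).2.2, (f (qk, n)).1.+1)) n.
pose F n := f (st n, n).
pose q n := (st n).1.
have qS n : (q n < q n.+1)%N by rewrite /q /= leq_max leqnn.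
have FN n : ((F n).2.2 <= q n.+1)%N by rewrite /q /= leq_maxr.
have qF n j : ~~ (q n <= j < q n.+1)%N -> (F n).2.1 j = 0.
  have [_ h _ _] := hf (st n, n); move=> nj; apply: h.
  by have := FN n; move: nj; rewrite -/(F n) -/(q n); lia.
have EF n : psum u xpredT (F n).2.1 (q n.+1) = psum u xpredT (F n).2.1 (F n).2.2.
  apply: psum_widen => // j Nj; have [_ h _ _] := hf (st n, n).
  by apply: h; rewrite [X in _ || X]Nj orbT.
have zF n : `|z (F n).1 - psum u xpredT (F n).2.1 (q n.+1)| <= 2^-1 ^+ n.
  by rewrite EF; have [] := hf (st n, n).
exists (fun n => (F n).1); split=> [n|].
  by have [+ _ _ _] := hf (st n.+1, n.+1).
apply: (perturbed_dominated e1 K0 mult zF).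
apply: (block_upper_estimate e1 K0 mult dom rdom uJ (q := q) _ qS qF _ (M := B + 1)) => // n.
  have [_ h + _] := hf (st n, n); rewrite -/(F n) in h *.
  rewrite -(big_mkord xpredT (F n).2.1) => s0.
  have s1 : \sum_(0 <= j < q n.+1) (F n).2.1 j = 0.
    rewrite (big_cat_nat _ (FN n))//= s0 add0r big_nat big1// => j /andP[Nj _].
    by apply: h; rewrite Nj orbT.
  move: s1; rewrite (big_cat_nat (leq0n _) (ltnW (qS n)))//= big_nat big1 ?add0r//.
  by move=> j /andP[_ jq]; apply: qF; lia.
rewrite -(subrK (z (F n).1) (psum _ _ _ _)) (le_trans (ler_normD _ _))//.
rewrite addrC lerD// distrC (le_trans (zF n))//.
by rewrite exprn_ile1// ?invr_ge0// invf_le1// ler1n.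
Qed.

(** In any partition only the interval containing [j] has a nonzero sum, and [e] is normalized. *)
Lemma J_unit_le j : `|u j| <= 1.
Proof.
pose d i : R := (i == j)%:R.
have -> : u j = psum u xpredT d j.+1.
  rewrite /psum big_ord_recr /= /d eqxx scale1r big1 ?add0r// => i _.
  by rewrite ltn_eqF ?scale0r.
apply: (Jnorm_le uJ) => [i ji|p k p0 pS]; first by rewrite /d gtn_eqF.
have [blk [blkP blkE]] := block_index p0 pS.
have E i : \sum_(p i <= m < p i.+1) d m = (i == blk j)%:R.
  have [->|ij] := eqVneq i (blk j).
    have /andP[j1 j2] := blkP j.
    rewrite (big_cat_nat j1 (ltnW j2))//= big_nat big1 ?add0r.
      rewrite big_ltn// /d eqxx big_nat big1 ?addr0// => m /andP[jm _].
      by rewrite gtn_eqF.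
    by move=> m /andP[_ mj]; rewrite /d ltn_eqF.
  rewrite big_nat big1// => m hm; rewrite /d; case: eqVneq => // mj.
  by move: ij; rewrite -mj (blkE _ _ hm) eqxx.
rewrite /interval_psum /psum; under eq_bigr do rewrite E.
have [jk|kj] := ltnP (blk j) k.
  rewrite (bigD1 (Ordinal jk))//= eqxx scale1r big1 ?addr0 ?e1// => i.
  by rewrite -val_eqE /= => /negPf->; rewrite scale0r.
rewrite big1 ?normr0// => i _; rewrite ltn_eqF ?scale0r//.
exact: leq_trans (ltn_ord i) kj.
Qed.

Lemma J_approx x (eps : R) : 0 < eps -> exists (a : nat -> R) (N : nat),
  (forall j, (N <= j)%N -> a j = 0) /\ `|x - psum u xpredT a N| <= eps.
Proof.
move=> eps0; have /closed_spanP/(_ eps eps0)[y [/spanP[c [n ->]] hy]] : closed_span u x.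
  by rewrite /closed_span uJ.1.
exists (fun j => if (j < n)%N then c j else 0), n; split.
  by move=> j; rewrite ltnNge => ->.
by rewrite psum_trunc.
Qed.

Lemma J_coef_le (a : nat -> R) N i : (forall j, (N <= j)%N -> a j = 0) ->
  `|a i| <= K * `|psum u xpredT a N|.
Proof.
move=> a0; rewrite (le_trans (coef_le e1 mult a (ltnSn i)))// ler_wpM2l//.
exact: psum_le_Jnorm.
Qed.

(** The coordinates before [q] are dropped and the total is cancelled by a multiple of [u q]. That
    multiple is at most the old total plus the dropped part, which is therefore counted twice; [L]
    exceeds [q] so that the correction is summed. *)
Lemma tail_projection q (a : nat -> R) N : (forall j, (N <= j)%N -> a j = 0) ->
  exists w, tail_zero_sum q w /\ `|psum u xpredT a N - w| <=
    2 * \sum_(j < q) `|a j| + `|\sum_(j < N) a j|.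
Proof.
move=> a0; pose L := maxn N q.+1.
have NL : (N <= L)%N by rewrite leq_maxl.
have qL : (q < L)%N by rewrite leq_maxr.
pose r := \sum_(j < L | (q <= j)%N) a j.
have sumL : \sum_(j < L) a j = \sum_(j < N) a j.
  rewrite -!(big_mkord xpredT a) (big_cat_nat _ NL)//=.
  by rewrite [X in _ + X]big_nat [X in _ + X]big1 ?addr0// => j /andP[/a0].
have rE : r = \sum_(j < N) a j - \sum_(j < q) a j.
  rewrite -sumL -(big_mkord xpredT a) (big_cat_nat _ (ltnW qL))//= big_mkord addrAC.
  rewrite subrr add0r /r -(big_mkord (leq q) a) (big_cat_nat _ (ltnW qL))//=.
  rewrite big_nat_cond big1 ?add0r => [|j]; last by lia.
  by rewrite big_nat_cond [RHS]big_nat; apply: eq_bigl => j; lia.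
pose b j := (if (q <= j)%N then a j else 0) + (if j == q then - r else 0).
exists (psum u xpredT b L); split.
  exists b, L; split=> //.
    move=> j /orP[jq|Lj]; rewrite /b.
      by rewrite leqNgt jq ltn_eqF// addr0.
    by rewrite a0 ?(leq_trans NL)// gtn_eqF ?(leq_trans qL)// if_same addr0.
  rewrite big_split /= -big_mkcond -/r.
  rewrite -(big_mkord xpredT (fun i => if i == q then - r else 0)) -big_mkcond /=.
  by rewrite big_mkord (big_pred1 (Ordinal qL)) ?subrr.
have -> : psum u xpredT a N - psum u xpredT b L = psum u xpredT a q + r *: u q.
  rewrite psumD -psum_if opprD addrA -(psum_widen u NL a0); congr (_ + _).
    rewrite (_ : psum u xpredT a L = psum u xpredT a q + psum u (leq q) a L) ?addrK//.
    rewrite -(psum_trunc u _ a (ltnW qL)) [psum u (leq q) a L]psum_if -psumD.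
    by apply: eq_bigr => i _; case: ltnP; rewrite ?addr0 ?add0r.
  rewrite /psum (bigD1 (Ordinal qL))//= eqxx big1 ?addr0 ?scaleNr ?opprK// => i.
  by rewrite -val_eqE /= => /negPf->; rewrite scale0r.
have h1 : `|psum u xpredT a q| <= \sum_(j < q) `|a j|.
  rewrite (le_trans (ler_norm_sum _ _ _))// ler_sum// => j _.
  by rewrite normrZ ler_piMr// J_unit_le.
have h2 : `|r *: u q| <= `|\sum_(j < N) a j| + \sum_(j < q) `|a j|.
  rewrite normrZ (@le_trans _ _ `|r|)//; first by rewrite ler_piMr// J_unit_le.
  by rewrite rE (le_trans (ler_normB _ _))// lerD// ler_norm_sum.
have := ler_normD (psum u xpredT a q) (r *: u q); lra.
Qed.

(** Coefficients and total sums of finite approximations are bounded by the norm of [J], so a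
    diagonal subsequence makes all of them Cauchy. Differences then have a small head and a small
    total, and [tail_projection] corrects both. *)
Lemma bounded_tail_cauchy (x : nat -> J) (B : R) : (forall k, `|x k| <= B) ->
  exists phi : nat -> nat, (forall k, (phi k < phi k.+1)%N) /\ tail_cauchy (x \o phi).
Proof.
move=> xB.
have /choice[f hf] : forall n : nat, exists aN : (nat -> R) * nat,
    (forall j, (aN.2 <= j)%N -> aN.1 j = 0) /\
    `|x n - psum u xpredT aN.1 aN.2| <= 2^-1 ^+ n.
  move=> n; have [|a [N h]] := @J_approx (x n) (2^-1 ^+ n).
    by rewrite exprn_gt0// invr_gt0.
  by exists (a, N).
pose a n := (f n).1; pose N n := (f n).2.
have a0 n : forall j, (N n <= j)%N -> a n j = 0 by exact: (hf n).1.
have aB n : `|psum u xpredT (a n) (N n)| <= B + 1.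
  rewrite -(subrK (x n) (psum _ _ _ _)) (le_trans (ler_normD _ _))//.
  rewrite addrC lerD// distrC (le_trans (hf n).2)//.
  by rewrite exprn_ile1// ?invr_ge0// invf_le1// ler1n.
(* Row 0 records total sums and row [i.+1] the coefficients at [i], so one diagonal argument treats
   both. *)
pose h i n := if i is i'.+1 then a n i' else \sum_(j < N n) a n j.
have [|phi [phiS hphi]] := @diagonal_subseq R h (fun i => (1 + K) * (B + 1)).
  have B1 : 0 <= B + 1 by exact: le_trans (normr_ge0 _) (aB 0%N).
  have KB : 0 <= K * (B + 1) by rewrite mulr_ge0.
  move=> [|i] n /=; rewrite mulrDl mul1r.
    by rewrite (le_trans (sum_le_Jnorm uJ e1 (a0 n)))// (le_trans (aB n))// lerDl.
  rewrite (le_trans (J_coef_le i (a0 n)))// (@le_trans _ _ (K * (B + 1)))//.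
    by rewrite ler_wpM2l.
  by rewrite lerDr.
have unif q eta : 0 < eta -> exists k1 : nat, forall i, (i <= q)%N -> forall n m,
    (k1 <= n)%N -> (k1 <= m)%N -> `|h i (phi n) - h i (phi m)| <= eta.
  move=> eta0; elim: q => [|q [k1 h1]].
    by have [k1 h1] := hphi 0%N _ eta0; exists k1 => i; rewrite leqn0 => /eqP->.
  have [k2 h2] := hphi q.+1 _ eta0.
  exists (maxn k1 k2) => i; rewrite leq_eqVlt => /orP[/eqP->|iq] n m.
    by rewrite !geq_max => /andP[_ ?] /andP[_ ?]; exact: h2.
  by rewrite !geq_max => /andP[? _] /andP[? _]; exact: h1.
exists phi; split=> // q eps eps0.
(* The projection costs [2 * q * eta + eta], at most [eps / 2]; the two approximations cost
   [eps / 4] each. *)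
pose eta := eps / (4 * q.+1%:R).
have eta0 : 0 < eta by rewrite divr_gt0// mulr_gt0.
have [k1 hk1] := unif q eta eta0.
have [k2 hk2] := @geom_small _ (eps / 4) 1 (divr_gt0 eps0 (ltr0n _ 4)).
exists (maxn k1 k2) => m n; rewrite !geq_max => /andP[m1 m2] /andP[n1 n2] /=.
pose M := maxn (N (phi m)) (N (phi n)).
pose d j := a (phi m) j - a (phi n) j.
have psumM k : (N k <= M)%N -> psum u xpredT (a k) M = psum u xpredT (a k) (N k).
  by move=> kM; apply: psum_widen => //; exact: a0.
have sumM k : (N k <= M)%N -> \sum_(j < M) a k j = h 0%N k.
  move=> kM; rewrite /= -!(big_mkord xpredT (a k)) (big_cat_nat _ kM)//=.
  by rewrite [X in _ + X]big_nat [X in _ + X]big1 ?addr0// => j /andP[/a0].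
have [|w [wq hw]] := @tail_projection q d M.
  move=> j; rewrite geq_max => /andP[? ?].
  by rewrite /d !a0 ?subrr.
exists w; split=> //.
have dM : psum u xpredT d M = psum u xpredT (a (phi m)) (N (phi m)) -
    psum u xpredT (a (phi n)) (N (phi n)).
  by rewrite psumD psumN !psumM ?leq_maxl ?leq_maxr.
have dsum : `|\sum_(j < M) d j| <= eta.
  by rewrite sumrB !sumM ?leq_maxl ?leq_maxr// hk1.
have dcoef : \sum_(j < q) `|d j| <= q%:R * eta.
  rewrite mulr_natl -[X in _ *+ X]card_ord -sumr_const ler_sum// => j _.
  exact: (hk1 j.+1).
have etaE : eps = 4 * (q%:R * eta + eta).
  have q1 : q%:R + 1 != 0 :> R by rewrite natr1 pnatr_eq0.
  by rewrite /eta -natr1; field.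
have hm := (hf (phi m)).2; have hn := (hf (phi n)).2.
have gm := hk2 _ (leq_trans m2 (increasing_ge_id phiS m)).
have gn := hk2 _ (leq_trans n2 (increasing_ge_id phiS n)).
have -> : x (phi m) - x (phi n) - w =
    (x (phi m) - psum u xpredT (a (phi m)) (N (phi m))) -
    (x (phi n) - psum u xpredT (a (phi n)) (N (phi n))) + (psum u xpredT d M - w).
  rewrite dM [RHS]addrA; congr (_ - _).
  by rewrite opprB [RHS]addrAC !addrA !subrK.
rewrite (le_trans (ler_normD _ _))//.
move: (ler_normB (x (phi m) - psum u xpredT (a (phi m)) (N (phi m)))
  (x (phi n) - psum u xpredT (a (phi n)) (N (phi n)))).
rewrite mul1r in gm; rewrite mul1r in gn.
move: hm hn gm gn hw dsum dcoef; rewrite -/(a _) -/(N _); lra.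
Qed.

End TailNull.

(** * Bilinear forms and domination of the biorthogonals *)

Section BilinearEstimates.
Context {R : realType} {X : normedModType R} {e : nat -> X} {K : R}.
Context {J : normedModType R}.
Hypothesis K0 : 0 <= K.
Hypothesis e1 : normalized e.
Hypothesis multx : forall x c, expands_to e c x ->
  forall (l : nat -> R) n, (forall i, `|l i| <= 1) ->
    `|psum e xpredT (fun i => l i * c i) n| <= K * `|x|.

Lemma multiplier (c l : nat -> R) n : (forall i, `|l i| <= 1) ->
  `|psum e xpredT (fun i => l i * c i) n| <= K * `|psum e xpredT c n|.
Proof.
move=> l1; have := multx (@expands_psum _ _ e c n) n l1.
apply: le_trans; rewrite le_eqVlt; apply/orP; left; apply/eqP; congr (`|_|).
by apply: eq_bigr => i _; rewrite ltn_ord.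
Qed.

Lemma expansion_coef_le c x i : expands_to e c x -> `|c i| <= K * `|x|.
Proof.
move=> /multx/(_ (fun j => (j == i)%:R) i.+1).
rewrite psum_nat big_nat_recr//= big_nat big1 ?add0r => [|j /andP[_ ji]]; last first.
  by rewrite ltn_eqF// mul0r scale0r.
by rewrite eqxx mul1r normrZ e1 mulr1; apply => j; case: eqP; rewrite ?normr1 ?normr0.
Qed.

(** Every coordinate of [x] is at most [K] times its norm, so the pairing is controlled by the [l1]
    norm of [a]. *)
Lemma l1_dominates_biorthogonals (C : R) :
  (forall N (b : nat -> R), \sum_(n < N) `|b n| <= C * `|psum e xpredT b N|) ->
  dominates_biorthogonals e.
Proof.
move=> hC; exists (C * K) => N a c x cx.
rewrite (le_trans (ler_norm_sum _ _ _))//.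
rewrite (@le_trans _ _ (\sum_(i < N) `|a i| * (K * `|x|)))//.
  by apply: ler_sum => i _; rewrite normrM ler_wpM2l// expansion_coef_le.
rewrite -mulr_suml [leRHS](_ : _ = C * `|\sum_(i < N) a i *: e i| * (K * `|x|)).
  by rewrite ler_wpM2r ?mulr_ge0//; exact: hC.
by ring.
Qed.

Hypothesis dom : dominates_normalized_block_bases e.

(** If [f] stayed away from 0 along a subsequence, testing it on suitably weighted sums would bound
    the [l1] norm of coefficients by their [e]-norm. Boundedness of [f] is asked only on
    combinations of [z], since an operator is linear only on its domain [E]. *)
Lemma functional_cvg0 (z : nat -> J) (f : J -> R) (M : R) :
  dominates e z ->
  (forall (phi : nat -> nat) N (b : nat -> R),
    `|\sum_(n < N) b n * f (z (phi n))| <= M * `|\sum_(n < N) b n *: z (phi n)|) ->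
  ~ dominates_biorthogonals e ->
  forall eps : R, 0 < eps ->
    exists n0 : nat, forall n, (n0 <= n)%N -> `|f (z n)| <= eps.
Proof.
move=> ez fM nb eps eps0; apply: contrapT => /forallNP H; apply: nb.
have [k N|phi [phiS hphi]] := @extract_subseq (fun _ n => eps < `|f (z n)|).
  have /existsNP[n /not_implyP[Nn /negP]] := H N; rewrite -ltNge => fn.
  by exists n.
have [C hC] := dominates_subseq e1 dom phiS ez.
apply: (@l1_dominates_biorthogonals (eps^-1 * (`|M| * (`|C| * K)))) => N b.
(* This weight turns each term into [eps] times the absolute value of [b n]; its modulus is at most
   1 because [f] exceeds [eps] in absolute value there. *)
pose l n := Num.sg (b n) * (eps / f (z (phi n))).
have f0 n : f (z (phi n)) != 0.
  by rewrite -normr_gt0 (lt_trans eps0).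
have l1 n : `|l n| <= 1.
  rewrite /l normrM normr_sg normrM normfV (gtr0_norm eps0) mulrA.
  rewrite ler_pdivrMr ?normr_gt0// mul1r (le_trans _ (ltW (hphi n)))//.
  by rewrite ler_piMl ?(ltW eps0)//; case: (b n != 0).
have -> : \sum_(n < N) `|b n| = eps^-1 * \sum_(n < N) (l n * b n) * f (z (phi n)).
  rewrite mulr_sumr; apply: eq_bigr => n _.
  rewrite normrEsg /l; move: (f0 n) (lt0r_neq0 eps0) => ? ?; field.
  by apply/andP.
rewrite -mulrA ler_wpM2l ?invr_ge0 ?(ltW eps0)// (le_trans (ler_norm _))//.
rewrite (le_trans (fM phi N (fun n => l n * b n)))//.
rewrite (le_trans (ler_wpM2r (normr_ge0 _) (ler_norm M)))// -mulrA ler_wpM2l//.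
rewrite (le_trans (hC N (fun n => l n * b n)))//.
rewrite (le_trans (ler_wpM2r (normr_ge0 _) (ler_norm C)))// -mulrA ler_wpM2l//.
exact: multiplier.
Qed.

(** The signs are fixed one at a time, each making the sum of its cross terms with the earlier ones
    nonnegative. *)
Lemma diagonal_le_signed_sum (B : nat -> nat -> R) N :
  exists eps : nat -> R, (forall i, `|eps i| <= 1) /\
    \sum_(n < N) B n n <= \sum_(n < N) \sum_(m < N) eps n * eps m * B n m.
Proof.
elim: N => [|N [eps [eps1 IH]]]; first by exists (fun=> 1); split; rewrite ?normr1// !big_ord0.
pose S := \sum_(n < N) eps n * B n N + \sum_(m < N) eps m * B N m.
pose s : R := if 0 <= S then 1 else -1.
have sS : 0 <= s * S.
  by rewrite /s; case: (lerP 0 S) => [|/ltW]; rewrite ?mul1r ?mulN1r ?oppr_ge0.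
have ss : s * s = 1 by rewrite /s; case: ifP; rewrite ?mulrNN ?mulr1.
exists (fun i => if i == N then s else eps i); split=> [i|].
  by case: ifP => // _; rewrite /s; case: ifP; rewrite ?normrN normr1.
rewrite big_ord_recr [leRHS]big_ord_recr /= eqxx.
under [X in _ <= X + _]eq_bigr do rewrite big_ord_recr /= eqxx (ltn_eqF (ltn_ord _)).
rewrite big_split /= big_ord_recr /= eqxx ss mul1r !addrA lerD2r.
have -> : \sum_(i < N) \sum_(j < N) eps i * (if j == N :> nat then s else eps j) * B i j =
   \sum_(i < N) \sum_(j < N) eps i * eps j * B i j.
  by apply: eq_bigr => i _; apply: eq_bigr => j _; rewrite (ltn_eqF (ltn_ord j)).
rewrite (le_trans IH)// -addrA lerDl; apply: le_trans sS _.
rewrite /S mulrDr !mulr_sumr lerD// ler_sum// => i _.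
  by rewrite mulrA [s * _]mulrC.
by rewrite mulrA (ltn_eqF (ltn_ord i)).
Qed.

(** The multipliers [delta / t n n] make the diagonal constant, and signs replace it by the full
    double sum. All these factors have modulus at most 1 and are absorbed by [multiplier] for [a]
    and by [multx] for the infinite expansion of [x]. *)
Lemma diagonal_pairing (z w : nat -> J) (t : nat -> nat -> R) (M delta : R) :
  0 < delta -> dominates e z -> dominates e w ->
  (forall N (b c : nat -> R), `|\sum_(n < N) \sum_(m < N) b n * c m * t n m| <=
     M * `|\sum_(n < N) b n *: z n| * `|\sum_(n < N) c n *: w n|) ->
  (forall n, delta <= `|t n n|) ->
  dominates_biorthogonals e.
Proof.
move=> delta0 [C hC] [D hD] tM tdelta.
exists (delta^-1 * (`|M| * (`|C| * K) * (`|D| * K))) => N a c x cx.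
pose s := Num.sg (\sum_(i < N) a i * c i).
have s1 : `|s| <= 1 by rewrite normr_sg; case: (_ != 0).
pose l n := delta / t n n.
have t0 n : t n n != 0 by rewrite -normr_gt0 (lt_le_trans delta0).
have l1 n : `|l n| <= 1.
  by rewrite normrM normfV (gtr0_norm delta0) ler_pdivrMr ?normr_gt0// mul1r.
have [eps [eps1 heps]] := diagonal_le_signed_sum
  (fun n m => (s * a n) * (l m * c m) * t n m) N.
have -> : `|\sum_(i < N) a i * c i| =
    delta^-1 * \sum_(n < N) (s * a n) * (l n * c n) * t n n.
  rewrite normrEsg -/s !mulr_sumr; apply: eq_bigr => n _; rewrite /l.
  by move: (t0 n) (lt0r_neq0 delta0) => ? ?; field; apply/andP.
rewrite -!(mulrA delta^-1) ler_wpM2l ?invr_ge0 ?(ltW delta0)// (le_trans heps)//.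
have -> : \sum_(n < N) \sum_(m < N) eps n * eps m * (s * a n * (l m * c m) * t n m) =
    \sum_(n < N) \sum_(m < N) (eps n * s * a n) * (eps m * l m * c m) * t n m.
  by apply: eq_bigr => n _; apply: eq_bigr => m _; ring.
rewrite (le_trans (ler_norm _))//.
rewrite (le_trans (tM N (fun n => eps n * s * a n) (fun n => eps n * l n * c n)))//.
have prod1 (y y' : R) : `|y| <= 1 -> `|y'| <= 1 -> `|y * y'| <= 1.
  by move=> h h'; rewrite normrM mulr_ile1.
have hz : `|\sum_(n < N) (eps n * s * a n) *: z n| <= `|C| * K * `|\sum_(i < N) a i *: e i|.
  rewrite (le_trans (hC N (fun n => eps n * s * a n)))//.
  rewrite (le_trans (ler_wpM2r (normr_ge0 _) (ler_norm C)))// -mulrA ler_wpM2l//.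
  by apply: (@multiplier a (fun n => eps n * s)) => n; exact: prod1.
have hw : `|\sum_(n < N) (eps n * l n * c n) *: w n| <= `|D| * K * `|x|.
  rewrite (le_trans (hD N (fun n => eps n * l n * c n)))//.
  rewrite (le_trans (ler_wpM2r (normr_ge0 _) (ler_norm D)))// -mulrA ler_wpM2l//.
  by apply: (multx cx (l := fun n => eps n * l n)) => n; exact: prod1.
rewrite (@le_trans _ _ (`|M| * (`|C| * K * `|\sum_(i < N) a i *: e i|) * (`|D| * K * `|x|)))//.
  rewrite (@le_trans _ _ (`|M| * `|\sum_(n < N) (eps n * s * a n) *: z n| *
      `|\sum_(n < N) (eps n * l n * c n) *: w n|))//.
    by rewrite ler_wpM2r// ler_wpM2r// ler_norm.
  by rewrite ler_pM ?mulr_ge0// ler_wpM2l.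
by rewrite le_eqVlt; apply/orP; left; apply/eqP; ring.
Qed.

End BilinearEstimates.

(** * Compactness of operators when the biorthogonals are not dominated *)

Section Compactness.
Context {R : realType} {X : normedModType R} {e : nat -> X} {K : R}.
Context {J : completeNormedModType R} {u : nat -> J}.
Hypothesis e1 : normalized e.
Hypothesis K0 : 0 <= K.
Hypothesis multx : forall x c, expands_to e c x ->
  forall (l : nat -> R) n, (forall i, `|l i| <= 1) ->
    `|psum e xpredT (fun i => l i * c i) n| <= K * `|x|.
Hypothesis dom : dominates_normalized_block_bases e.
Hypothesis rdom : right_dominant e.
Hypothesis uJ : is_J_space e u.

Section Operator.
Context {E : set J} {T : J -> J -> R}.
Hypothesis subE : closed_subspace E.
Hypothesis opT : bounded_op_to_dual E T.

Lemma subspaceB x y : E x -> E y -> E (x - y).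
Proof.
case: subE => _ [_ [ED EZ]] Ex Ey; apply: ED => //.
by rewrite -scaleN1r; exact: EZ.
Qed.

Lemma op0r x : E x -> T x 0 = 0.
Proof.
case: opT => Tr _ Ex; have := Tr x Ex 1 0 0; rewrite scale1r addr0 mul1r.
by rewrite -[X in X = _]addr0 => /addrI.
Qed.

Lemma opZr x l y : E x -> T x (l *: y) = l * T x y.
Proof. by case: opT => Tr _ Ex; have := Tr x Ex l y 0; rewrite op0r// !addr0. Qed.

Lemma opBr x y y' : E x -> T x (y - y') = T x y - T x y'.
Proof.
case: opT => Tr _ Ex; have := Tr x Ex (-1) y' y.
by rewrite scaleN1r mulN1r addrC [RHS]addrC.
Qed.

Lemma opBl x x' y : E x -> E x' -> T (x - x') y = T x y - T x' y.
Proof.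
case: opT => _ [Tl _] Ex Ex'; have := Tl x' x (-1) Ex' Ex y.
by rewrite scaleN1r mulN1r addrC [RHS]addrC.
Qed.

Lemma op_suml (z : nat -> J) (b : nat -> R) N y : (forall n, E (z n)) ->
  E (\sum_(n < N) b n *: z n) /\
  T (\sum_(n < N) b n *: z n) y = \sum_(n < N) b n * T (z n) y.
Proof.
case: opT => Tr [Tl _]; case: subE => _ [E0 [ED EZ]] Ez.
elim: N => [|N [IH1 IH2]].
  rewrite !big_ord0; split=> //.
  by have := opBl y E0 E0; rewrite !subrr.
rewrite !big_ord_recr /=; split; first by apply: ED => //; exact: EZ.
by rewrite addrC Tl// IH2 addrC.
Qed.

Lemma op_sumr x (w : nat -> J) (c : nat -> R) N : E x ->
  T x (\sum_(n < N) c n *: w n) = \sum_(n < N) c n * T x (w n).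
Proof.
case: opT => Tr _ Ex; elim: N => [|N IH]; first by rewrite !big_ord0 op0r.
by rewrite !big_ord_recr /= addrC Tr// IH addrC.
Qed.

Lemma op_cauchy_limit (x : nat -> J) (B : R) : (forall n, E (x n)) ->
  (forall n, `|x n| <= B) ->
  (forall eps : R, 0 < eps -> exists n0 : nat, forall n m, (n0 <= n)%N -> (n0 <= m)%N ->
     forall y, `|y| <= 1 -> `|T (x n) y - T (x m) y| <= eps) ->
  exists f : J -> R,
    (forall (l : R) y z, f (l *: y + z) = l * f y + f z) /\
    (exists M : R, forall y, `|f y| <= M * `|y|) /\
    (forall eps : R, 0 < eps -> exists n0 : nat, forall n, (n0 <= n)%N ->
       forall y, `|y| <= 1 -> `|T (x n) y - f y| <= eps).
Proof.
move=> Ex xB xC; case: (opT) => Tr [_ [C TC]].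
have /choice[f hf] : forall y, exists l : R^o, (fun n => T (x n) y : R^o) @ \oo --> l.
  move=> y; have [|l hl] := @cauchy_seq_cvg R R^o (fun n => T (x n) y).
    (* The Cauchy condition concerns the unit ball only; dividing by the norm plus 1 brings any [y]
       into it, 0 included. *)
    move=> eps eps0; have y1 : 0 < `|y| + 1 by rewrite ltr_wpDl.
    have [|n0 h] := xC (eps / (`|y| + 1)); first by rewrite divr_gt0.
    exists n0 => n m nn nm; have := h n m nn nm ((`|y| + 1)^-1 *: y).
    have ny w : `|(`|y| + 1)^-1 * w| = `|w| / (`|y| + 1).
      by rewrite normrM normfV (gtr0_norm y1) mulrC.
    rewrite normrZ normfV (gtr0_norm y1) mulrC ler_pdivrMr// mul1r lerDl ler01.
    move=> /(_ isT); rewrite !opZr// -mulrBr ny ler_pM2r ?invr_gt0//.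
  by exists l; apply/cvg_seqP.
exists f; split.
  move=> l y z; have h1 := hf (l *: y + z).
  have h2 : (fun n => l *: (T (x n) y : R^o) + T (x n) z) @ \oo --> (l *: f y + f z : R^o).
    by apply: cvgD => //; apply: cvgZr.
  apply: (@cvg_unique _ (@norm_hausdorff _ _) _ _ _ _ h1).
  rewrite (_ : (fun n => T (x n) (l *: y + z)) = fun n => l *: (T (x n) y : R^o) + T (x n) z)//.
  by apply/funext => n; rewrite Tr.
split.
  exists (`|C| * B) => y; apply: norm_le_lim (hf y) _ => n.
  rewrite (le_trans (TC _ _ (Ex n)))// ler_wpM2r//.
  rewrite (le_trans (ler_wpM2r (normr_ge0 _) (ler_norm C)))// ler_wpM2l//.
move=> eps /xC[n0 h]; exists n0 => n nn y y1.
apply/ler_addgt0Pr => eta /((cvg_seqP _ _).1 (hf y))[m0 hm].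
have h1 := hm _ (leq_maxl m0 n0); have h2 := h n _ nn (leq_maxr m0 n0) y y1.
rewrite -(subrK (T (x (maxn m0 n0)) y) (T (x n) y)) -addrA (le_trans (ler_normD _ _))//.
by rewrite lerD// distrC.
Qed.

Lemma op_compact : ~ dominates_biorthogonals e -> compact_op_to_dual E T.
Proof.
move=> nb x B Ex xB; case: (opT) => Tr [Tl [C TC]].
have mult := multiplier multx.
have [phi [phiS phiC]] := bounded_tail_cauchy e1 K0 mult uJ xB.
exists phi; pose x' n := x (phi n).
suff cau : forall eps : R, 0 < eps -> exists n0 : nat, forall n m,
    (n0 <= n)%N -> (n0 <= m)%N ->
    forall y, `|y| <= 1 -> `|T (x' n) y - T (x' m) y| <= eps.
  have [f hf] := op_cauchy_limit (fun n => Ex (phi n)) (fun n => xB (phi n)) cau.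
  by exists f.
move=> eps eps0; apply: contrapT => /forallNP H; apply: nb.
have /choice[f hf] : forall k : nat, exists nmy : (nat * nat) * J,
    [/\ (k <= nmy.1.1)%N, (k <= nmy.1.2)%N, `|nmy.2| <= 1 &
     eps < `|T (x' nmy.1.1) nmy.2 - T (x' nmy.1.2) nmy.2|].
  move=> k; apply: contrapT => /forallNP H'; apply: (H k) => n m kn km y y1.
  rewrite leNgt; apply/negP => h; exact: (H' ((n, m), y)).
pose z k := x' (f k).1.1 - x' (f k).1.2; pose y k := (f k).2.
have Ez k : E (z k) by apply: subspaceB; exact: Ex.
have zy k : eps < `|T (z k) (y k)|.
  by rewrite opBl//; [have [] := hf k|exact: Ex|exact: Ex].
have z0 : tail_null (u := u) z.
  by apply: (tail_cauchy_null phiC) => k; have [] := hf k.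
have zB k : `|z k| <= B + B by rewrite (le_trans (ler_normB _ _))// lerD// xB.
have [psi [psiS zpsi]] := tail_null_dominated_subseq e1 K0 mult dom rdom uJ z0 zB.
have [|chi [chiS chiC]] := @bounded_tail_cauchy R X e K J u e1 K0 mult uJ (y \o psi) 1.
  by move=> k; have [] := hf (psi k).
have zchi := dominates_subseq e1 dom chiS zpsi.
set z' := (z \o psi) \o chi in zchi; set y' := (y \o psi) \o chi in chiC.
have Ez' k : E (z' k) by exact: Ez.
(* Assuming the goal false restores the hypothesis under which [functional_cvg0] excludes the [l1]
   case. *)
apply: contrapT => nb.
have zcvg v : forall d : R, 0 < d -> exists n0 : nat, forall n, (n0 <= n)%N ->
    `|T (z' n) v| <= d.
  apply: (functional_cvg0 (f := T ^~ v) (M := `|C| * `|v|) K0 e1 multx dom zchi _ nb).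
  move=> p N b; have [Es <-] := op_suml b N v (fun n => Ez' (p n)).
  by rewrite (le_trans (TC _ _ Es))// mulrAC ler_wpM2r// ler_wpM2r// ler_norm.
have e2 : 0 < eps / 2 by rewrite divr_gt0.
(* [b k] is so late that the functional at [z' (b k)] almost ignores [y' k]. Subtracting [y' k] from
   [y' (b k)] makes [w] tail null and still leaves more than [eps / 2] on the diagonal. *)
have [k N|b [bS hb]] := @extract_subseq (fun k b => `|T (z' b) (y' k)| <= eps / 2).
  have [n0 h] := zcvg (y' k) _ e2.
  by exists (maxn N n0); split; [exact: leq_maxl|exact/h/leq_maxr].
have bk k : (k <= b k)%N by exact: increasing_ge_id.
pose w k := y' (b k) - y' k.
have w0 : tail_null (u := u) w by apply: (tail_cauchy_null chiC).
have y'1 k : `|y' k| <= 1 by have [] := hf (psi (chi k)).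
have wB k : `|w k| <= 1 + 1 by rewrite (le_trans (ler_normB _ _))// lerD.
have [tau [tauS wtau]] := tail_null_dominated_subseq e1 K0 mult dom rdom uJ w0 wB.
have zb := dominates_subseq e1 dom tauS (dominates_subseq e1 dom bS zchi).
apply: nb.
pose t n m := T (z' (b (tau n))) (w (tau m)).
have pair := diagonal_pairing multx (t := t) (M := `|C|) e2 zb wtau.
apply: pair => [N c d|n].
  have Ezb n : E (((z' \o b) \o tau) n) by exact: Ez'.
  have [Es Eq] := op_suml c N (\sum_(m < N) d m *: (w \o tau) m) Ezb.
  have -> : \sum_(n < N) \sum_(m < N) c n * d m * T (z' (b (tau n))) (w (tau m)) =
      T (\sum_(n < N) c n *: ((z' \o b) \o tau) n) (\sum_(m < N) d m *: (w \o tau) m).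
    rewrite Eq; apply: eq_bigr => n _; rewrite op_sumr// mulr_sumr.
    by apply: eq_bigr => m _; rewrite mulrA.
  by rewrite (le_trans (TC _ _ Es))// ler_wpM2r// ler_wpM2r// ler_norm.
rewrite /t opBr//.
have h1 : eps < `|T (z' (b (tau n))) (y' (b (tau n)))| by exact: zy.
have h2 := hb (tau n).
have := ler_normB (T (z' (b (tau n))) (y' (b (tau n))) - T (z' (b (tau n))) (y' (tau n)))
  (- T (z' (b (tau n))) (y' (tau n))).
rewrite opprK subrK normrN; lra.
Qed.

End Operator.
End Compactness.

(** * Coordinates on [J] and the noncompact operator *)

Section Coordinates.
Context {R : realType} {X : normedModType R} {e : nat -> X} {K : R}.
Context {J : normedModType R} {u : nat -> J}.
Hypothesis e1 : normalized e.
Hypothesis K0 : 0 <= K.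
Hypothesis mult : forall (c l : nat -> R) n, (forall i, `|l i| <= 1) ->
  `|psum e xpredT (fun i => l i * c i) n| <= K * `|psum e xpredT c n|.
Hypothesis uJ : is_J_space e u.

Lemma psum_sub_le_Jnorm (a b : nat -> R) M N n :
  (forall j, (M <= j)%N -> a j = 0) -> (forall j, (N <= j)%N -> b j = 0) ->
  `|psum e xpredT (fun i => a i - b i) n| <=
  `|psum u xpredT a M - psum u xpredT b N|.
Proof.
move=> a0 b0; rewrite -(psum_widen u (leq_maxl M N) a0) -(psum_widen u (leq_maxr M N) b0).
rewrite -psumN -psumD; apply: (psum_le_Jnorm uJ) => j.
by rewrite geq_max => /andP[Mj Nj]; rewrite a0// b0// subrr.
Qed.

(** Coordinates are limits of those of finite approximations, which are Cauchy because coefficients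
    are bounded by the norm of [J]. This one estimate later yields linearity, boundedness and the
    values at [u]. *)
Lemma J_coordinates : exists c : J -> nat -> R,
  forall x (a : nat -> R) N n, (forall j, (N <= j)%N -> a j = 0) ->
    `|psum e xpredT (fun i => c x i - a i) n| <= `|x - psum u xpredT a N|.
Proof.
suff /choice[c hc] : forall x, exists c : nat -> R,
    forall (a : nat -> R) N n, (forall j, (N <= j)%N -> a j = 0) ->
    `|psum e xpredT (fun i => c i - a i) n| <= `|x - psum u xpredT a N|.
  by exists c.
move=> x.
have /choice[f hf] : forall m : nat, exists bM : (nat -> R) * nat,
    (forall j, (bM.2 <= j)%N -> bM.1 j = 0) /\
    `|x - psum u xpredT bM.1 bM.2| <= 2^-1 ^+ m.
  move=> m; have [|a [N h]] := J_approx uJ x (eps := 2^-1 ^+ m).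
    by rewrite exprn_gt0// invr_gt0.
  by exists (a, N).
have f0 m : forall j, ((f m).2 <= j)%N -> (f m).1 j = 0 := (hf m).1.
have f_near (a : nat -> R) N n m : (forall j, (N <= j)%N -> a j = 0) ->
    `|psum e xpredT (fun i => (f m).1 i - a i) n| <=
    `|x - psum u xpredT a N| + 2^-1 ^+ m.
  move=> a0; rewrite (le_trans (psum_sub_le_Jnorm n (f0 m) a0))//.
  rewrite -(subrK x (psum u xpredT (f m).1 _)) -addrA (le_trans (ler_normD _ _))//.
  by rewrite [leRHS]addrC lerD// distrC; exact: (hf m).2.
have /choice[c hc] : forall i, exists l : R^o, (fun m => (f m).1 i : R^o) @ \oo --> l.
  move=> i; have [|l hl] := @cauchy_seq_cvg R R^o (fun m => (f m).1 i).
    move=> eps eps0; have [n0 hn0] := geom_small (2 * K) eps0.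
    exists n0 => n m nn nm.
    have h1 := coef_le e1 mult (fun i => (f n).1 i - (f m).1 i) (ltnSn i).
    have h2 := f_near (f m).1 (f m).2 i.+1 n (f0 m).
    have h3 := ler_wpM2l K0 (le_trans h2 (lerD (hf m).2 (lexx _))).
    have g1 := hn0 _ nn; have g2 := hn0 _ nm.
    rewrite (le_trans h1)// (le_trans h3)//; lra.
  by exists l; apply/cvg_seqP.
exists c => a N n a0.
apply/ler_addgt0Pr => eps eps0; have [n0 hn0] := geom_small 1 eps0.
(* The shift by [n0] discards the approximations with error above [eps], so the bound holds along
   the whole sequence. *)
have cv : (fun m => psum e xpredT (fun i => (f (m + n0)%N).1 i - a i) n) @ \oo -->
    psum e xpredT (fun i => c i - a i) n.
  apply: (@psum_cvg R X e xpredT (fun m i => (f (m + n0)%N).1 i - a i)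
    (fun i => c i - a i) n) => i.
  apply: cvgB; last exact: cvg_cst.
  by rewrite (@cvg_shiftn n0 _ (fun m => (f m).1 i : R^o)); exact: hc.
apply: norm_le_lim cv _ => m; rewrite (le_trans (f_near _ N _ _ a0))// lerD2l.
by rewrite -[leLHS]mul1r hn0// leq_addl.
Qed.

End Coordinates.

Section DiagonalOperator.
Context {R : realType} {X : normedModType R} {e : nat -> X} {K : R}.
Context {J : completeNormedModType R} {u : nat -> J}.
Hypothesis e1 : normalized e.
Hypothesis K0 : 0 <= K.
Hypothesis mult : forall (c l : nat -> R) n, (forall i, `|l i| <= 1) ->
  `|psum e xpredT (fun i => l i * c i) n| <= K * `|psum e xpredT c n|.
Hypothesis uJ : is_J_space e u.

Lemma noncompact_operator : dominates_biorthogonals e ->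
  exists T : J -> J -> R, bounded_op_to_dual setT T /\ ~ compact_op_to_dual setT T.
Proof.
move=> [C0 hC0]; have [c hc] := J_coordinates e1 K0 mult uJ.
have c_lin i l x y : c (l *: x + y) i = l * c x i + c y i.
  apply/eqP; rewrite -subr_eq0 -normr_le0; apply/ler_addgt0Pr => eps eps0; rewrite add0r.
  have b0 : 0 < 2 * (K + 1) * (`|l| + 1) by rewrite !mulr_gt0// ltr_wpDl.
  (* Errors [d] in [x] and [y] cost at most K (|l| + 1) d on each side of the identity, hence the 2;
     [K + 1] keeps the divisor positive. *)
  pose d := eps / (2 * (K + 1) * (`|l| + 1)).
  have d0 : 0 < d by rewrite divr_gt0.
  have [a [M [a0 ha]]] := J_approx uJ x d0.
  have [b [N [bb0 hb]]] := J_approx uJ y d0.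
  pose ab j := l * a j + b j.
  have ab0 j : (maxn M N <= j)%N -> ab j = 0.
    by rewrite geq_max => /andP[Mj Nj]; rewrite /ab a0// bb0// mulr0 addr0.
  have abE : psum u xpredT ab (maxn M N) = l *: psum u xpredT a M + psum u xpredT b N.
    rewrite -(psum_widen u (leq_maxl M N) a0) -(psum_widen u (leq_maxr M N) bb0).
    by rewrite -psumZ -psumD.
  have key z (g : nat -> R) L : (forall j, (L <= j)%N -> g j = 0) ->
      `|c z i - g i| <= K * `|z - psum u xpredT g L|.
    move=> g0; have := coef_le e1 mult (fun i => c z i - g i) (ltnSn i).
    by move=> /le_trans; apply; rewrite ler_wpM2l// hc.
  have h1 := key x a M a0; have h2 := key y b N bb0.
  have h3 := key (l *: x + y) ab _ ab0.
  have h4 : `|l *: x + y - psum u xpredT ab (maxn M N)| <= `|l| * d + d.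
    rewrite abE opprD addrACA -scalerBr (le_trans (ler_normD _ _))// lerD//.
    by rewrite normrZ ler_wpM2l.
  have -> : c (l *: x + y) i - (l * c x i + c y i) =
      (c (l *: x + y) i - ab i) - (l * (c x i - a i) + (c y i - b i)).
    by rewrite /ab; ring.
  rewrite (le_trans (ler_normB _ _))// (le_trans (lerD (lexx _) (ler_normD _ _)))//.
  rewrite normrM.
  have k1 := ler_wpM2l K0 h4; have k2 := ler_wpM2l K0 ha; have k3 := ler_wpM2l K0 hb.
  have k4 := ler_wpM2l (normr_ge0 l) (le_trans h1 k2).
  have -> : eps = 2 * (K + 1) * (`|l| + 1) * d by rewrite /d mulrC divfK// gt_eqF.
  have : 0 <= d * (`|l| + 1) by rewrite mulr_ge0 ?addr_ge0// ltW.
  lra.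
have c_psum x n : `|psum e xpredT (c x) n| <= `|x|.
  have := hc x (fun=> 0) 0%N n (fun _ _ => erefl); rewrite {2}/psum big_ord0 subr0.
  by apply: le_trans; rewrite le_eqVlt; apply/orP; left; apply/eqP; congr (`|_|);
    apply: eq_bigr => i _; rewrite subr0.
have c_u m i : c (u m) i = (i == m)%:R.
  have uE : psum u xpredT (fun j => (j == m)%:R) m.+1 = u m.
    rewrite /psum big_ord_recr /= eqxx scale1r big1 ?add0r// => j _.
    by rewrite ltn_eqF ?scale0r.
  have h1 := coef_le e1 mult (fun j => c (u m) j - (j == m)%:R) (ltnSn i).
  have h2 : `|psum e xpredT (fun j => c (u m) j - (j == m)%:R) i.+1| <= 0.
    have := hc (u m) (fun j => (j == m)%:R) m.+1 i.+1.
    by rewrite uE subrr normr0; apply => j mj; rewrite gtn_eqF.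
  apply/eqP; rewrite -subr_eq0 -normr_le0 (le_trans h1)//.
  by rewrite mulr_ge0_le0.
(* The sign multiplier upgrades the bound on pairings to absolute convergence. Truncation at [n]
   makes the coordinates of [y] the expansion of a vector of [X], of norm at most that of [y]. *)
have c_abs x y n : \sum_(i < n) `|c x i * c y i| <= `|C0| * K * `|x| * `|y|.
  pose s i := Num.sg (c x i * c y i).
  have s1 i : `|s i| <= 1 by rewrite normr_sg; case: (_ != 0).
  have := hC0 n (fun i => s i * c x i) (fun i => if (i < n)%N then c y i else 0)
    _ (@expands_psum _ _ e (c y) n).
  have -> : \sum_(i < n) s i * c x i * (if (i < n)%N then c y i else 0) =
      \sum_(i < n) `|c x i * c y i|.
    by apply: eq_bigr => i _; rewrite ltn_ord normrEsg /s mulrA.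
  rewrite ger0_norm ?sumr_ge0// => /le_trans; apply.
  have h : `|\sum_(i < n) (s i * c x i) *: e i| <= K * `|x|.
    by rewrite (le_trans (mult (c x) n s1))// ler_wpM2l.
  have h' := ler_wpM2r (normr_ge0 (\sum_(i < n) (s i * c x i) *: e i)) (ler_norm C0).
  apply: le_trans (ler_wpM2r (normr_ge0 _) h') _.
  rewrite -(mulrA `|C0|); apply: ler_pM => //.
  by rewrite ler_wpM2l.
have /choice[T hT] : forall xy : J * J, exists l : R^o,
    (fun n => \sum_(i < n) c xy.1 i * c xy.2 i : R^o) @ \oo --> l.
  move=> [x y] /=; apply/cvg_ex.
  rewrite (_ : (fun n => _) = series (fun i => c x i * c y i : R^o)); last first.
    by apply/funext => n; rewrite /series /= big_mkord.
  apply: normed_cvg; apply: nondecreasing_is_cvgn.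
    by apply/nondecreasing_seqP => n /=; rewrite seriesSr lerDl.
  exists (`|C0| * K * `|x| * `|y|) => _ [n _ <-].
  by have := c_abs x y n; rewrite -(big_mkord xpredT (fun i => `|c x i * c y i|)).
exists (fun x y => T (x, y)); split.
  have lin2 x y y' l : T (x, l *: y + y') = l * T (x, y) + T (x, y').
    have h2 : (fun n => l *: (\sum_(i < n) c x i * c y i : R^o) +
        \sum_(i < n) c x i * c y' i) @ \oo --> (l *: T (x, y) + T (x, y') : R^o).
      by apply: cvgD (hT (x, y')); apply: cvgZr (hT (x, y)).
    apply: (@cvg_unique _ (@norm_hausdorff _ _) _ _ _ _ (hT (x, l *: y + y'))).
    rewrite (_ : (fun n => _) = fun n => l *: (\sum_(i < n) c x i * c y i : R^o) +
        \sum_(i < n) c x i * c y' i)//.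
    apply/funext => n; rewrite scaler_sumr -big_split; apply: eq_bigr => i _ /=.
    by rewrite c_lin /GRing.scale /=; ring.
  have TC x y : T (x, y) = T (y, x).
    apply: (@cvg_unique _ (@norm_hausdorff _ _) _ _ _ _ (hT (x, y))).
    rewrite (_ : (fun n => _) = fun n => \sum_(i < n) c y i * c x i : R^o).
      exact: hT.
    by apply/funext => n; apply: eq_bigr => i _; rewrite mulrC.
  split=> [x _ l y z|]; first exact: lin2.
  split=> [x x' l _ _ y|]; first by rewrite TC lin2 !(TC y).
  exists (`|C0| * K) => x y _; apply: norm_le_lim (hT (x, y)) _ => n.
  by rewrite (le_trans (ler_norm_sum _ _ _)).
have T_u m m' : T (u m, u m') = (m == m')%:R.
  apply: (@cvg_unique _ (@norm_hausdorff _ _) _ _ _ _ (hT (u m, u m'))).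
  apply/cvg_seqP => eps eps0; exists m.+1 => n mn.
  rewrite (bigD1 (Ordinal mn))//= !c_u eqxx mul1r big1 => [|i]; last first.
    by rewrite -val_eqE /= c_u => /negPf->; rewrite mul0r.
  by rewrite addr0 subrr normr0 ltW.
(* At [u (phi n)] the images of [u (phi n)] and [u (phi n.+1)] take the values 1 and 0, so they
   cannot both be within 1/4 of the limit functional. *)
move=> /(_ u 1 (fun _ => Logic.I) (J_unit_le e1 uJ))[phi [f [phiS [_ [_ hf]]]]].
have quarter_gt0 : 0 < 4^-1 :> R by rewrite invr_gt0.
have [n hn] := hf (4^-1) quarter_gt0.
have h1 := hn n (leqnn n) (u (phi n)) (J_unit_le e1 uJ _).
have h2 := hn n.+1 (leqnSn n) (u (phi n)) (J_unit_le e1 uJ _).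
move: h1 h2; rewrite !T_u eqxx gtn_eqF//.
rewrite !ler_norml /= => /andP[a1 a2] /andP[b1 b2]; lra.
Qed.

End DiagonalOperator.

Theorem theorem3 (R : realType) (X : completeNormedModType R) (e : nat -> X)
  (J : completeNormedModType R) (u : nat -> J) :
  normalized e -> basic_seq e -> right_dominant e ->
  dominates_normalized_block_bases e -> is_J_space e u ->
  ((forall E : set J, closed_subspace E ->
      forall T : J -> J -> R, bounded_op_to_dual E T -> compact_op_to_dual E T)
   <-> ~ dominates_biorthogonals e).
Proof.
move=> e1 eB eR eD uJ; have [K K0 multx] := unconditional_constant e1 eR.1.
split=> [compact_ops bio|nb E subE T opT].
  have [T [opT ncT]] := noncompact_operator e1 K0 (multiplier multx) uJ bio.
  apply: ncT; apply: compact_ops opT; split; first exact: closedT.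
  by [].
exact: (op_compact e1 K0 multx eD eR uJ subE opT nb).
Qed.
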